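(* Let $(p_n)$ be a sequence with $0<\liminf_{n\to\infty} p_n\leq \limsup_{n\to\infty} p_n<1$, let $p=p_n$, $q=q_n=1-p_n$, and let $j=j_n$ be integers with $0\leq j_n\leq n$. Put $V=npq$ and $y=\frac{j-np+1/2}{\sqrt{V}}$. Then, as $n\to\infty$, \[ \sum_{k=0}^j \binom{n}{k}p^k q^{n-k}=\Phi(y)+ \frac{e^{-\frac{1}{2}y^2}}{\sqrt{2\pi}}\Big(\frac{P_1}{\sqrt{V}}+\frac{P_2}{V}+\frac{P_3}{V^{3/2}}+\frac{P_4}{V^2}\Big)+O\Big(\frac{1}{n^{5/2}}\Big), \] where \begin{itemize} \item $P_1=\frac{1}{6}(q-p)(1-y^2)$, \item $P_2=y\big[\frac{1}{72}(-3+7y^2-y^4)-\frac{pq}{36}(-3+11y^2-2y^4)\big]$, \item $P_3=(q-p)\big[\frac{1}{6480}(123+129y^2-384y^4+95y^6-5y^8)-\frac{pq}{3240}(3+69y^2-399y^4+145y^6-10y^8)\big]$, \item $P_4=y\big[\frac{1}{155520}(-4293-1359y^2+6165y^4-1971y^6+185y^8-5y^{10})+\frac{pq}{38880}(3105+1395y^2-7794y^4+2979y^6-325y^8+10y^{10})+\frac{p^2 q^2}{38880}(135-1035y^2+7947y^4-4167y^6+560y^8-20y^{10})\big]$. \end{itemize}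
   Context: $\Phi$ denotes the standard normal cumulative distribution function. *)

(* Defs.v *)
From Stdlib Require Import Reals.
From Coquelicot Require Import Coquelicot.
Open Scope R_scope.

Definition std_normal_density (t : R) : R := exp (- t ^ 2 / 2) / sqrt (2 * PI).
Definition Phi (y : R) : R :=
  RInt_gen std_normal_density (Rbar_locally m_infty) (at_point y).

Definition P1 (p q y : R) : R := / 6 * (q - p) * (1 - y ^ 2).
Definition P2 (p q y : R) : R :=
  y * (/ 72 * (-3 + 7 * y ^ 2 - y ^ 4) - p * q / 36 * (-3 + 11 * y ^ 2 - 2 * y ^ 4)).
Definition P3 (p q y : R) : R :=
  (q - p) * (/ 6480 * (123 + 129 * y ^ 2 - 384 * y ^ 4 + 95 * y ^ 6 - 5 * y ^ 8)
             - p * q / 3240 * (3 + 69 * y ^ 2 - 399 * y ^ 4 + 145 * y ^ 6 - 10 * y ^ 8)).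
Definition P4 (p q y : R) : R :=
  y * (/ 155520 * (-4293 - 1359 * y ^ 2 + 6165 * y ^ 4 - 1971 * y ^ 6 + 185 * y ^ 8 - 5 * y ^ 10)
       + p * q / 38880 * (3105 + 1395 * y ^ 2 - 7794 * y ^ 4 + 2979 * y ^ 6 - 325 * y ^ 8 + 10 * y ^ 10)
       + p ^ 2 * q ^ 2 / 38880 * (135 - 1035 * y ^ 2 + 7947 * y ^ 4 - 4167 * y ^ 6 + 560 * y ^ 8 - 20 * y ^ 10)).

(* Binomial CDF  sum_{k=0}^{j} C(n,k) p^k q^(n-k)  (sum_f_R0 f j has j+1 terms) *)
Definition binom_cdf (n j : nat) (p : R) : R :=
  sum_f_R0 (fun k => Binomial.C n k * p ^ k * (1 - p) ^ (n - k)) j.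

(* Main.v *)
(* Let b be the binomial probabilities, h = 1/sqrt(npq), y_k = (k - np + 1/2) h, let G be the
   approximating function with its four correction terms, and D(k) = G(y_k) - G(y_{k-1}).
   Since (n-k) p b(k) = (k+1) q b(k+1), it is enough to know how far D is from satisfying the
   same recurrence: r(k) = (n-k) p D(k) - (k+1) q D(k+1).  Expanding around the common point y_k,
   the polynomials P1, ..., P4 are exactly those that cancel all orders below h^7 in h^2 r(k), so
   that |r(k)| <= C h^5 / (1 + y_k^2) for every k.  Writing D = b d, one has
   r(k) = T(k) (d(k) - d(k+1)) with T(k) = (n-k) p b(k), and summation by parts bounds the error
   of the distribution function F by the sum of F (1 - F) |r| / T, up to the values of G and 1 - G
   at the ends of the lattice, which are negligible.  Finally F (1 - F) <= C h T, because T is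
   the partial sum of (np - i) b(i). *)
Require Import Defs.
From Stdlib Require Import Reals Lra Lia List Factorial.
From Coquelicot Require Import Coquelicot.
Import ListNotations.
Open Scope R_scope.

(** * The Gaussian integral *)

Definition gauss_int (x : R) : R := RInt (fun t => exp (- t ^ 2 / 2)) 0 x.

Lemma continuous_gauss (x : R) : continuous (fun t => exp (- t ^ 2 / 2)) x.
Proof.
  apply (@ex_derive_continuous R_AbsRing R_NormedModule).
  auto_derive; easy.
Qed.

Lemma is_derive_gauss_int (x : R) : is_derive gauss_int x (exp (- x ^ 2 / 2)).
Proof.
  apply (is_derive_RInt (fun t => exp (- t ^ 2 / 2)) gauss_int 0 x).
  - exists (mkposreal 1 Rlt_0_1); intros z _.
    apply (@RInt_correct R_CompleteNormedModule), (@ex_RInt_continuous R_CompleteNormedModule).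
    intros; apply continuous_gauss.
  - apply continuous_gauss.
Qed.

Lemma gauss_int_0 : gauss_int 0 = 0.
Proof. apply (@RInt_point R_CompleteNormedModule). Qed.

Lemma exp_le (x y : R) : x <= y -> exp x <= exp y.
Proof. intros [H| ->]; [left; now apply exp_increasing | right; reflexivity]. Qed.

(* Integrated over [0, 1] in [t], this has [x]-derivative [- 2 exp (- x^2/2) * gauss_int x],
   which cancels the derivative of [gauss_int x ^ 2]. *)
Definition gauss_param (x t : R) : R := 2 * exp (- x ^ 2 * (1 + t ^ 2) / 2) / (1 + t ^ 2).

Lemma ex_RInt_gauss_param (x a b : R) : ex_RInt (gauss_param x) a b.
Proof.
  apply (@ex_RInt_continuous R_CompleteNormedModule); intros t _.
  apply (@ex_derive_continuous R_AbsRing R_NormedModule).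
  unfold gauss_param; auto_derive; nra.
Qed.

Lemma is_derive_gauss_param (x t : R) :
  is_derive (fun u => gauss_param u t) x (- 2 * x * exp (- x ^ 2 * (1 + t ^ 2) / 2)).
Proof.
  unfold gauss_param; auto_derive; [nra|].
  simpl; unfold Rdiv; field; nra.
Qed.

(** Joint continuity of the partial derivative is what permits differentiation under the integral
    sign. *)
Lemma continuity_2d_gauss_param (x t : R) :
  continuity_2d_pt (fun u v => Derive (fun z => gauss_param z v) u) x t.
Proof.
  apply continuity_2d_pt_ext
    with (fun u v => (- 2 * u) * exp ((- / 2) * (u * u * (1 + v * v)))).
  { intros u v; symmetry; etransitivity.
    - apply is_derive_unique, is_derive_gauss_param.
    - f_equal; f_equal; field. }
  apply continuity_2d_pt_mult.
  - apply continuity_2d_pt_mult; [apply continuity_2d_pt_const | apply continuity_2d_pt_id1].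
  - apply (continuity_1d_2d_pt_comp exp).
    + apply derivable_continuous_pt, derivable_pt_exp.
    + repeat first [apply continuity_2d_pt_mult | apply continuity_2d_pt_plus
        | apply continuity_2d_pt_const | apply continuity_2d_pt_id1 | apply continuity_2d_pt_id2].
Qed.

(** Substitution u = x t: the exponential splits as exp (- x^2/2) exp (- (x t)^2/2), and the factor
    x is the Jacobian. *)
Lemma RInt_gauss_scaled (x : R) :
  RInt (fun t => - 2 * x * exp (- x ^ 2 * (1 + t ^ 2) / 2)) 0 1
  = - 2 * exp (- x ^ 2 / 2) * gauss_int x.
Proof.
  unfold gauss_int.
  replace (RInt (fun t => exp (- t ^ 2 / 2)) 0 x)
    with (RInt (fun t => exp (- t ^ 2 / 2)) (x * 0 + 0) (x * 1 + 0)) by (f_equal; ring).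
  rewrite <- (RInt_comp_lin (V := R_CompleteNormedModule))
    by (apply (@ex_RInt_continuous R_CompleteNormedModule); intros; apply continuous_gauss).
  rewrite <- (RInt_scal (V := R_CompleteNormedModule)).
  - apply RInt_ext; intros t _; unfold scal; simpl; unfold mult; simpl.
    replace (- (x * (x * 1)) * (1 + t * (t * 1)) / 2)
      with (- (x * (x * 1)) / 2 + - ((x * t + 0) * ((x * t + 0) * 1)) / 2) by field.
    rewrite exp_plus; ring.
  - apply (@ex_RInt_continuous R_CompleteNormedModule); intros t _.
    apply (@ex_derive_continuous R_AbsRing R_NormedModule).
    unfold scal; simpl; unfold mult; simpl; auto_derive; easy.
Qed.

(** The left side has zero derivative in x, and at x = 0 it is the integral of 2/(1 + t^2), that is
    2 atan 1. *)
Lemma gauss_int_sq_plus (x : R) : gauss_int x ^ 2 + RInt (gauss_param x) 0 1 = PI / 2.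
Proof.
  assert (Hd : forall z, is_derive (fun u => gauss_int u ^ 2 + RInt (gauss_param u) 0 1) z 0).
  { intros z.
    evar_last.
    - apply (@is_derive_plus R_AbsRing R_NormedModule).
      + apply (is_derive_pow gauss_int 2), is_derive_gauss_int.
      + apply is_derive_RInt_param.
        * exists (mkposreal 1 Rlt_0_1); intros u _ t _.
          eexists; apply is_derive_gauss_param.
        * intros t _; apply continuity_2d_gauss_param.
        * exists (mkposreal 1 Rlt_0_1); intros u _; apply ex_RInt_gauss_param.
    - rewrite (RInt_ext _ (fun t => - 2 * z * exp (- z ^ 2 * (1 + t ^ 2) / 2))).
      + rewrite RInt_gauss_scaled; unfold plus; simpl; ring.
      + intros t _; apply is_derive_unique, is_derive_gauss_param. }
  assert (H0 : gauss_int 0 ^ 2 + RInt (gauss_param 0) 0 1 = PI / 2).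
  { rewrite gauss_int_0, (RInt_ext _ (fun t => scal 2 (/ (1 + t ^ 2)))).
    - rewrite (RInt_scal (V := R_CompleteNormedModule)).
      + replace (RInt (fun t => / (1 + t ^ 2)) 0 1) with (minus (atan 1) (atan 0)).
        * rewrite atan_1, atan_0; unfold minus, scal, plus, opp; simpl; unfold mult; simpl; field.
        * symmetry; apply is_RInt_unique, (is_RInt_derive atan).
          -- intros t _; apply is_derive_Reals, derivable_pt_lim_atan.
          -- intros t _; apply (@ex_derive_continuous R_AbsRing R_NormedModule).
             auto_derive; nra.
      + apply (@ex_RInt_continuous R_CompleteNormedModule); intros t _.
        apply (@ex_derive_continuous R_AbsRing R_NormedModule); auto_derive; nra.
    - intros t _; unfold gauss_param, scal; simpl; unfold mult; simpl.
      replace (- (0 * (0 * 1)) * (1 + t * (t * 1)) / 2) with 0 by field.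
      rewrite exp_0; field; nra. }
  rewrite <- H0.
  destruct (MVT_gen (fun u => gauss_int u ^ 2 + RInt (gauss_param u) 0 1) 0 x (fun _ => 0))
    as [c [_ Hc]].
  - intros z _; apply Hd.
  - intros z _; apply derivable_continuous_pt; exists 0; apply is_derive_Reals, Hd.
  - lra.
Qed.

Lemma gauss_int_sq_bounds (x : R) :
  PI / 2 - 2 * exp (- x ^ 2 / 2) <= gauss_int x ^ 2 <= PI / 2.
Proof.
  pose proof (gauss_int_sq_plus x) as H.
  assert (H0 : 0 <= RInt (gauss_param x) 0 1).
  { apply RInt_ge_0; [lra | apply ex_RInt_gauss_param | intros t _].
    unfold gauss_param.
    apply Rmult_le_pos; [pose proof (exp_pos (- x ^ 2 * (1 + t ^ 2) / 2)); lra|].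
    left; apply Rinv_0_lt_compat; nra. }
  assert (H1 : RInt (gauss_param x) 0 1 <= RInt (fun _ => 2 * exp (- x ^ 2 / 2)) 0 1).
  { apply RInt_le; [lra | apply ex_RInt_gauss_param | apply ex_RInt_const | intros t _].
    unfold gauss_param.
    assert (He : exp (- x ^ 2 * (1 + t ^ 2) / 2) <= exp (- x ^ 2 / 2)).
    { apply exp_le; assert (0 <= x ^ 2 * t ^ 2) by (apply Rmult_le_pos; nra); nra. }
    pose proof (exp_pos (- x ^ 2 / 2)).
    assert (0 <= exp (- x ^ 2 / 2) * t ^ 2) by (apply Rmult_le_pos; nra).
    assert (Ht : 1 + t ^ 2 > 0) by nra.
    apply (proj2 (Rle_div_l _ _ _ Ht)).
    apply Rle_trans with (2 * exp (- x ^ 2 / 2)); lra. }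
  rewrite RInt_const in H1; unfold scal in H1; simpl in H1; unfold mult in H1; simpl in H1.
  simpl in *; lra.
Qed.

(** * The normal distribution function *)

(** The distribution function as a proper integral, normalised by its value 1/2 at 0; [Phi_eq]
    identifies it with [Phi]. *)
Definition Phi0 (y : R) : R := / 2 + gauss_int y / sqrt (2 * PI).

Lemma sqrt_2PI_pos : 0 < sqrt (2 * PI).
Proof. apply sqrt_lt_R0; pose proof PI_RGT_0; lra. Qed.

Lemma sqrt_2PI_ge_2 : 2 <= sqrt (2 * PI).
Proof.
  pose proof PI2_1; apply Rle_trans with (sqrt (2 * 2)).
  - rewrite sqrt_square; lra.
  - apply sqrt_le_1_alt; lra.
Qed.

Lemma is_derive_Phi0 (y : R) : is_derive Phi0 y (std_normal_density y).
Proof.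
  unfold Phi0, std_normal_density.
  auto_derive.
  - eexists; apply is_derive_gauss_int.
  - replace (Derive (fun x => gauss_int x) y) with (exp (- y ^ 2 / 2)).
    + unfold Rdiv; simpl; ring.
    + symmetry; apply is_derive_unique, is_derive_gauss_int.
Qed.

(** Selects the sign of the square root when bounds on [gauss_int x ^ 2] are turned into bounds on
    [gauss_int x]. *)
Lemma gauss_int_sign (x : R) : 0 <= x * gauss_int x.
Proof.
  destruct (MVT_gen gauss_int 0 x (fun z => exp (- z ^ 2 / 2))) as [c [_ Hc]].
  - intros z _; apply is_derive_gauss_int.
  - intros z _; apply derivable_continuous_pt; eexists; apply is_derive_Reals, is_derive_gauss_int.
  - rewrite gauss_int_0 in Hc.
    pose proof (exp_pos (- c ^ 2 / 2)); nra.
Qed.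

(* With s = sqrt (2 PI), (s/2 - I)(s/2 + I) = PI/2 - I^2 is at most 2 exp(-x^2/2). *)
Lemma Phi0_tail (x : R) : 0 < x -> Rabs (1 - Phi0 x) <= exp (- x ^ 2 / 2).
Proof.
  intros Hx; unfold Phi0.
  pose proof (gauss_int_sign x) as Hs; pose proof (gauss_int_sq_bounds x) as Hb.
  pose proof sqrt_2PI_pos as Hp; pose proof sqrt_2PI_ge_2 as Hp2.
  assert (Hsq : sqrt (2 * PI) * sqrt (2 * PI) = 2 * PI)
    by (apply sqrt_sqrt; pose proof PI_RGT_0; lra).
  assert (HI : 0 <= gauss_int x) by nra.
  set (s := sqrt (2 * PI)) in *; set (I := gauss_int x) in *.
  assert (HIs : I <= s / 2) by nra.
  replace (1 - (/ 2 + I / s)) with ((s / 2 - I) / s) by (field; lra).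
  rewrite Rabs_pos_eq by (apply Rmult_le_pos; [lra | left; apply Rinv_0_lt_compat; lra]).
  apply (proj2 (Rle_div_l _ _ _ Hp)).
  assert ((s / 2 - I) * (s / 2) <= 2 * exp (- x ^ 2 / 2)) by nra.
  assert (0 < exp (- x ^ 2 / 2)) by apply exp_pos.
  nra.
Qed.

Lemma gauss_int_opp (x : R) : gauss_int (- x) = - gauss_int x.
Proof.
  assert (Hd : forall z, is_derive (fun z => gauss_int (- z) + gauss_int z) z 0).
  { intros z; evar_last.
    + apply (@is_derive_plus R_AbsRing R_NormedModule); [|apply is_derive_gauss_int].
      apply (is_derive_comp gauss_int Ropp); [apply is_derive_gauss_int|].
      apply (@is_derive_opp R_AbsRing R_NormedModule), is_derive_id.
    + unfold plus, scal, opp, one; simpl; unfold mult, one; simpl.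
      replace (- z * (- z * 1)) with (z * (z * 1)) by ring; ring. }
  destruct (MVT_gen (fun z => gauss_int (- z) + gauss_int z) 0 x (fun _ => 0)) as [c [_ Hc]].
  - intros z _; apply Hd.
  - intros z _; apply derivable_continuous_pt; exists 0; apply is_derive_Reals, Hd.
  - rewrite Ropp_0, gauss_int_0 in Hc; lra.
Qed.

Lemma Phi0_opp (x : R) : Phi0 (- x) = 1 - Phi0 x.
Proof. unfold Phi0; rewrite gauss_int_opp; field; apply Rgt_not_eq, sqrt_2PI_pos. Qed.

Lemma filterlim_Phi0_m_infty : filterlim Phi0 (Rbar_locally m_infty) (locally 0).
Proof.
  apply filterlim_locally; intros eps.
  (* Beyond this threshold x^2/2 > 1/eps, hence exp (x^2/2) > 1/eps. *)
  exists (- (1 + 2 / eps)); intros x Hx.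
  assert (He : 0 < 2 / eps) by (apply Rdiv_lt_0_compat; [lra | apply cond_pos]).
  unfold ball; simpl; unfold AbsRing_ball, minus, plus, opp, abs; simpl.
  replace (Phi0 x + - 0) with (1 - Phi0 (- x)) by (rewrite Phi0_opp; ring).
  eapply Rle_lt_trans; [apply Phi0_tail; lra|].
  replace (- (- x) ^ 2 / 2) with (- (x ^ 2 / 2)) by field.
  rewrite exp_Ropp.
  assert (H1 : / eps < exp (x ^ 2 / 2)).
  { eapply Rlt_le_trans; [|apply exp_ineq1_le].
    replace (/ eps) with (2 / eps / 2) by (field; apply Rgt_not_eq, cond_pos); nra. }
  rewrite <- (Rinv_inv eps).
  apply Rinv_lt_contravar; [|exact H1].
  apply Rmult_lt_0_compat; [apply Rinv_0_lt_compat, cond_pos | apply exp_pos].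
Qed.

Lemma Phi_eq (y : R) : Phi y = Phi0 y.
Proof.
  unfold Phi.
  apply is_RInt_gen_unique; try typeclasses eauto.
  assert (HD : forall x, Derive Phi0 x = std_normal_density x)
    by (intros; apply is_derive_unique, is_derive_Phi0).
  assert (Hc : forall x, continuous std_normal_density x).
  { intros x; apply (@ex_derive_continuous R_AbsRing R_NormedModule).
    unfold std_normal_density; auto_derive; easy. }
  apply (is_RInt_gen_ext (Derive Phi0)).
  { apply filter_forall; intros ab x _; apply HD. }
  replace (Phi0 y) with (Phi0 y - 0) by ring.
  apply is_RInt_gen_Derive.
  - apply filter_forall; intros ab x _; eexists; apply is_derive_Phi0.
  - apply filter_forall; intros ab x _.
    apply (continuous_ext std_normal_density); [intros; symmetry; apply HD | apply Hc].
  - exact filterlim_Phi0_m_infty.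
  - intros P HP; unfold filtermap, at_point; apply locally_singleton, HP.
Qed.

(** * Taylor expansion of Gaussian polynomials *)

Fixpoint psum (f : nat -> R) (n : nat) : R :=
  match n with O => 0 | S m => psum f m + f m end.

(** [F m] stands for the m-th derivative of [F 0]. There are [N] terms, so the degree in [t] is at
    most N - 1. *)
Definition taylor (F : nat -> R -> R) (N : nat) (y t : R) : R :=
  psum (fun m => t ^ m / INR (fact m) * F m y) N.

Lemma is_derive_taylor (F : nat -> R -> R) (N : nat) (y t : R) :
  is_derive (taylor F (S N) y) t (taylor (fun m => F (S m)) N y t).
Proof.
  induction N as [|N IH]; unfold taylor in *.
  - simpl; auto_derive; [easy | field].
  - evar_last.
    + apply (@is_derive_plus R_AbsRing R_NormedModule); [exact IH|].
      evar_last; [auto_derive; [easy | reflexivity] | reflexivity].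
    + change (psum (fun m => t ^ m / INR (fact m) * F (S m) y) (S N))
        with (psum (fun m => t ^ m / INR (fact m) * F (S m) y) N
              + t ^ N / INR (fact N) * F (S N) y).
      change (match N with 0%nat => 1 | S _ => INR N + 1 end) with (INR (S N)).
      change (fact N + N * fact N)%nat with (S N * fact N)%nat; rewrite mult_INR.
      unfold plus; cbn -[INR pow psum fact].
      pose proof (INR_fact_neq_0 N); pose proof (not_0_INR (S N) ltac:(lia)).
      field; split; assumption.
Qed.

Lemma taylor_0 (F : nat -> R -> R) (N : nat) (y : R) : taylor F (S N) y 0 = F O y.
Proof.
  unfold taylor; induction N as [|N IH]; [simpl; field|].
  change (psum ?f (S (S N))) with (psum f (S N) + f (S N)); cbv beta.
  rewrite IH, pow_ne_zero by lia; unfold Rdiv; ring.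
Qed.

(** Induction over all families [F]: the remainder vanishes at t = 0, and its derivative is the
    remainder of the shifted family with one term fewer. The mean value theorem then gains a factor
    |t|; no factorial is gained. *)
Lemma taylor_remainder (N : nat) : forall (F : nat -> R -> R) (y t M : R),
  (forall m z, is_derive (F m) z (F (S m) z)) ->
  (forall s, Rabs s <= Rabs t -> Rabs (F N (y + s)) <= M) ->
  Rabs (F O (y + t) - taylor F N y t) <= M * Rabs t ^ N.
Proof.
  induction N as [|N IH]; intros F y t M HF HM.
  - unfold taylor; simpl; rewrite Rminus_0_r, Rmult_1_r; apply HM, Rle_refl.
  - set (r := fun s => F O (y + s) - taylor F (S N) y s).
    assert (Hr : forall s, is_derive r s (F 1%nat (y + s) - taylor (fun m => F (S m)) N y s)).
    { intros s; apply (@is_derive_minus R_AbsRing R_NormedModule); [|apply is_derive_taylor].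
      evar_last.
      - apply (is_derive_comp (F O) (fun s => y + s)); [apply HF|].
        auto_derive; [easy | reflexivity].
      - unfold scal; simpl; unfold mult; simpl; ring. }
    destruct (MVT_gen r 0 t (fun s => F 1%nat (y + s) - taylor (fun m => F (S m)) N y s))
      as [c [Hc Hct]].
    + intros; apply Hr.
    + intros; apply derivable_continuous_pt; eexists; apply is_derive_Reals, Hr.
    + assert (Hc' : Rabs c <= Rabs t).
      { unfold Rmin, Rmax in Hc; destruct (Rle_dec 0 t); unfold Rabs;
          destruct (Rcase_abs c), (Rcase_abs t); lra. }
      change (F O (y + t) - taylor F (S N) y t) with (r t).
      replace (r t) with (r t - r 0)
        by (unfold r; rewrite taylor_0, Rplus_0_r; ring).
      rewrite Hct, Rabs_mult, Rminus_0_r.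
      replace (M * Rabs t ^ S N) with (M * Rabs t ^ N * Rabs t) by (simpl; ring).
      apply Rmult_le_compat_r; [apply Rabs_pos|].
      eapply Rle_trans.
      * apply (IH (fun m => F (S m)) y c M); [intros; apply HF|].
        intros s Hs; apply HM; lra.
      * apply Rmult_le_compat_l.
        -- eapply Rle_trans; [apply Rabs_pos | apply (HM 0)].
           rewrite Rabs_R0; apply Rabs_pos.
        -- apply pow_incr; split; [apply Rabs_pos | exact Hc'].
Qed.

(** * Polynomials times the normal density *)

(** Coefficients start with the constant term. They are integers so that iterated derivatives can be
    evaluated by computation. *)
Fixpoint peval (l : list Z) (y : R) : R :=
  match l with [] => 0 | a :: l => IZR a + y * peval l y end.

Fixpoint psub (l m : list Z) : list Z :=
  match l, m with
  | [], _ => map Z.opp m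
  | _, [] => l
  | a :: l, b :: m => (a - b)%Z :: psub l m
  end.

(* The derivative of [a + y l(y)] is [l + y l' = l - (- y l')]. *)
Fixpoint pderiv (l : list Z) : list Z :=
  match l with [] => [] | _ :: l => psub l (0%Z :: map Z.opp (pderiv l)) end.

(** The density f satisfies f' = - y f, so (f l)' = f (l' - y l). *)
Definition gauss_deriv (l : list Z) : list Z := psub (pderiv l) (0%Z :: l).

Lemma peval_opp (l : list Z) (y : R) : peval (map Z.opp l) y = - peval l y.
Proof. induction l as [|a l IH]; simpl; [ring | rewrite IH, opp_IZR; ring]. Qed.

Lemma peval_sub (l : list Z) : forall (m : list Z) (y : R),
  peval (psub l m) y = peval l y - peval m y.
Proof.
  induction l as [|a l IH]; intros [|b m] y; simpl; rewrite ?peval_opp, ?opp_IZR; try ring.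
  rewrite IH, minus_IZR; ring.
Qed.

Lemma is_derive_peval (l : list Z) (y : R) : is_derive (peval l) y (peval (pderiv l) y).
Proof.
  induction l as [|a l IH].
  - apply (@is_derive_const R_AbsRing R_NormedModule).
  - evar_last.
    + apply (@is_derive_plus R_AbsRing R_NormedModule);
        [apply (@is_derive_const R_AbsRing R_NormedModule)|].
      apply (is_derive_mult (fun z => z) (peval l)); [apply is_derive_id | exact IH | apply Rmult_comm].
    + simpl pderiv; rewrite peval_sub; simpl; rewrite peval_opp.
      unfold plus, zero, mult, one; simpl; unfold plus, mult, one; simpl; ring.
Qed.

Definition gpoly (l : list Z) (y : R) : R := std_normal_density y * peval l y.

Lemma is_derive_gpoly (l : list Z) (y : R) :
  is_derive (gpoly l) y (gpoly (gauss_deriv l) y).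
Proof.
  assert (Hd : is_derive std_normal_density y (- y * std_normal_density y)).
  { unfold std_normal_density; auto_derive; [easy|].
    simpl; unfold Rdiv; field; apply Rgt_not_eq, sqrt_2PI_pos. }
  unfold gpoly; evar_last.
  - apply (is_derive_mult std_normal_density (peval l));
      [exact Hd | apply is_derive_peval | apply Rmult_comm].
  - unfold gauss_deriv; rewrite peval_sub; simpl.
    unfold plus, mult; simpl; ring.
Qed.

Lemma peval_bound (l : list Z) :
  exists A, 0 <= A /\ forall y, Rabs (peval l y) <= A * (1 + y ^ 2) ^ length l.
Proof.
  induction l as [|a l [A [HA IH]]].
  - exists 0; split; [lra|]; intros y; simpl; rewrite Rabs_R0; lra.
  - exists (Rabs (IZR a) + A); split; [pose proof (Rabs_pos (IZR a)); lra|]; intros y.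
    assert (H1 : 1 <= 1 + y ^ 2) by nra.
    cbn [peval length].
    eapply Rle_trans; [apply Rabs_triang|]; rewrite Rabs_mult, Rmult_plus_distr_r.
    apply Rplus_le_compat.
    + rewrite <- (Rmult_1_r (Rabs (IZR a))) at 1.
      apply Rmult_le_compat_l; [apply Rabs_pos | apply pow_R1_Rle, H1].
    + replace (A * (1 + y ^ 2) ^ S (length l)) with ((1 + y ^ 2) * (A * (1 + y ^ 2) ^ length l))
        by (simpl; ring).
      apply Rmult_le_compat; [apply Rabs_pos | apply Rabs_pos | | apply IH].
      unfold Rabs; destruct Rcase_abs; nra.
Qed.

(** With c = 2 (N + 1), raise (1 + u)/c <= exp ((1 + u)/c) to the power N; the resulting exponent is
    at most (1 + u)/2. *)
Lemma exp_dominates_pow (N : nat) : exists C, forall u, 0 <= u -> exp (- u / 2) * (1 + u) ^ N <= C.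
Proof.
  set (c := 2 * INR (S N)).
  assert (Hc : 0 < c) by (unfold c; pose proof (lt_0_INR (S N) ltac:(lia)); lra).
  exists (c ^ N * exp (/ 2)); intros u Hu.
  assert (H1 : (1 + u) / c <= exp ((1 + u) / c)) by (pose proof (exp_ineq1_le ((1 + u) / c)); lra).
  assert (H2 : forall k, exp ((1 + u) / c) ^ k = exp (INR k * ((1 + u) / c))).
  { induction k as [|k IH]; [rewrite Rmult_0_l, exp_0; reflexivity|].
    rewrite S_INR, Rmult_plus_distr_r, Rmult_1_l, exp_plus, <- IH; simpl; ring. }
  assert (H3 : ((1 + u) / c) ^ N <= exp (u / 2) * exp (/ 2)).
  { eapply Rle_trans.
    - apply pow_incr; split; [|exact H1].
      apply Rmult_le_pos; [lra | left; apply Rinv_0_lt_compat, Hc].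
    - rewrite H2, <- exp_plus; apply exp_le.
      unfold c; pose proof (pos_INR N); rewrite S_INR.
      replace (INR N * ((1 + u) / (2 * (INR N + 1)))) with ((1 + u) / 2 * (INR N / (INR N + 1)))
        by (field; lra).
      assert (HN : INR N + 1 > 0) by lra.
      assert (INR N / (INR N + 1) <= 1) by (apply (proj2 (Rle_div_l _ _ _ HN)); lra).
      nra. }
  replace ((1 + u) ^ N) with (c ^ N * ((1 + u) / c) ^ N)
    by (rewrite <- Rpow_mult_distr; f_equal; field; lra).
  replace (exp (- u / 2)) with (/ exp (u / 2))
    by (rewrite <- exp_Ropp; f_equal; field).
  pose proof (exp_pos (u / 2)) as He.
  apply Rmult_le_reg_l with (exp (u / 2)); [exact He|].
  replace (exp (u / 2) * (/ exp (u / 2) * (c ^ N * ((1 + u) / c) ^ N)))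
    with (c ^ N * ((1 + u) / c) ^ N) by (field; lra).
  replace (exp (u / 2) * (c ^ N * exp (/ 2))) with (c ^ N * (exp (u / 2) * exp (/ 2))) by ring.
  apply Rmult_le_compat_l; [apply pow_le; lra | exact H3].
Qed.

Lemma std_normal_density_le (y : R) : 0 < std_normal_density y <= exp (- y ^ 2 / 2).
Proof.
  unfold std_normal_density; pose proof (exp_pos (- y ^ 2 / 2)) as He.
  pose proof sqrt_2PI_ge_2; pose proof sqrt_2PI_pos as Hs; split.
  - apply Rdiv_lt_0_compat; assumption.
  - apply (proj2 (Rle_div_l _ _ _ Hs)); nra.
Qed.

Lemma gpoly_decay (l : list Z) (K : nat) :
  exists C, 0 <= C /\ forall y, Rabs (gpoly l y) <= C / (1 + y ^ 2) ^ K.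
Proof.
  destruct (peval_bound l) as [A [HA Hl]].
  destruct (exp_dominates_pow (length l + K)) as [C HC].
  assert (HC0 : 0 <= C).
  { eapply Rle_trans; [|apply (HC 0); lra].
    apply Rmult_le_pos; [left; apply exp_pos | apply pow_le; lra]. }
  exists (A * C); split; [nra|]; intros y.
  assert (Hy : 0 < (1 + y ^ 2) ^ K) by (apply pow_lt; nra).
  apply (proj1 (Rle_div_r _ _ _ Hy)).
  unfold gpoly; rewrite Rabs_mult.
  destruct (std_normal_density_le y) as [H0 H1].
  rewrite (Rabs_pos_eq (std_normal_density y)) by lra.
  specialize (HC (y ^ 2) ltac:(nra)); rewrite pow_add in HC.
  apply Rle_trans with (exp (- y ^ 2 / 2) * (A * (1 + y ^ 2) ^ length l) * (1 + y ^ 2) ^ K).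
  - apply Rmult_le_compat_r; [lra|].
    apply Rmult_le_compat; [lra | apply Rabs_pos | exact H1 | apply Hl].
  - replace (exp (- y ^ 2 / 2) * (A * (1 + y ^ 2) ^ length l) * (1 + y ^ 2) ^ K)
      with (A * (exp (- y ^ 2 / 2) * ((1 + y ^ 2) ^ length l * (1 + y ^ 2) ^ K))) by ring.
    apply Rmult_le_compat_l; assumption.
Qed.

(** Uniformity over |s| <= 1 covers the intermediate points of Taylor remainders. The square leaves
    one factor 1/(1 + y^2) after multiplication by y. *)
Definition rapid (f : R -> R) : Prop :=
  exists C, 0 <= C /\ forall y s, Rabs s <= 1 -> Rabs (f (y + s)) <= C / (1 + y ^ 2) ^ 2.

Lemma rapid_gpoly (l : list Z) : rapid (gpoly l).
Proof.
  destruct (gpoly_decay l 2) as [C [HC H]].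
  (* Here 9 = 3^2, because 1 + y^2 <= 3 (1 + (y + s)^2). *)
  exists (9 * C); split; [lra|]; intros y s Hs.
  eapply Rle_trans; [apply H|].
  assert (H3 : 1 + y ^ 2 <= 3 * (1 + (y + s) ^ 2)).
  { apply Rabs_le_between in Hs; assert (s ^ 2 <= 1) by nra.
    pose proof (pow2_ge_0 (y + 2 * s)); nra. }
  unfold Rdiv; replace (9 * C * / (1 + y ^ 2) ^ 2) with (C * (9 * / (1 + y ^ 2) ^ 2)) by ring.
  apply Rmult_le_compat_l; [exact HC|].
  replace (9 * / (1 + y ^ 2) ^ 2) with (/ ((1 + y ^ 2) / 3) ^ 2) by (field; nra).
  apply Rinv_le_contravar; [apply pow_lt; nra|].
  apply pow_incr; nra.
Qed.

(** * Taylor expansion of the recurrence operator *)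

Definition smooth_seq (F : nat -> R -> R) : Prop :=
  (forall m z, is_derive (F m) z (F (S m) z)) /\ forall m, rapid (F (S m)).

Definition gpoly_seq (l : list Z) (m : nat) : R -> R := gpoly (Nat.iter m gauss_deriv l).

Lemma smooth_gpoly_seq (l : list Z) : smooth_seq (gpoly_seq l).
Proof. split; intros; [apply is_derive_gpoly | apply rapid_gpoly]. Qed.

Definition Phi_seq (m : nat) : R -> R :=
  match m with O => Phi0 | S m => gpoly_seq [1%Z] m end.

Lemma smooth_Phi_seq : smooth_seq Phi_seq.
Proof.
  split; [|intros; apply rapid_gpoly].
  intros [|m] z; [|apply is_derive_gpoly].
  evar_last; [apply is_derive_Phi0|].
  unfold Phi_seq, gpoly_seq, gpoly; simpl; ring.
Qed.

Lemma smooth_taylor (F : nat -> R -> R) (N : nat) : smooth_seq F -> (1 <= N)%nat ->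
  exists C, 0 <= C /\ forall y t, Rabs t <= 1 ->
    Rabs (F O (y + t) - taylor F N y t) <= C * Rabs t ^ N / (1 + y ^ 2) ^ 2.
Proof.
  intros [HF HR] HN; destruct N as [|N]; [lia|].
  destruct (HR N) as [C [HC H]]; exists C; split; [exact HC|]; intros y t Ht.
  replace (C * Rabs t ^ S N / (1 + y ^ 2) ^ 2) with (C / (1 + y ^ 2) ^ 2 * Rabs t ^ S N)
    by (unfold Rdiv; ring).
  apply taylor_remainder; [exact HF|]; intros s Hs; apply H; lra.
Qed.

(* If [y = (k - np + 1/2) h] with [h^2 npq = 1], then [stein g p h y / h^2] equals
   [(n-k) p (g y - g (y-h)) - (k+1) q (g (y+h) - g y)], which vanishes when [g] is replaced by
   the binomial distribution function on the lattice. *)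
Definition stein (g : R -> R) (p h y : R) : R :=
  (1 - p * y * h + p * h ^ 2 / 2) * (g y - g (y - h))
  - (1 + (1 - p) * y * h + (1 - p) * h ^ 2 / 2) * (g (y + h) - g y).

(* [stein] with Taylor polynomials in place of the differences; their order drops by the degree
   in [h] of the factor in front, so that no term of order above [h ^ (K + 1)] is left over. *)
Definition stein_main (F : nat -> R -> R) (K : nat) (p h y : R) : R :=
  let d N := F O y - taylor F N y (- h) in
  let u N := taylor F N y h - F O y in
  (d (K + 2)%nat - u (K + 2)%nat)
  - y * h * (p * d (K + 1)%nat + (1 - p) * u (K + 1)%nat)
  + h ^ 2 / 2 * (p * d K - (1 - p) * u K).

(** Taylor remainders with K + 2, K + 1 and K terms meet the factors 1, y h and h^2, so each
    contributes order h^(K+2). The factor y consumes one of the two powers of 1/(1 + y^2). *)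
Lemma stein_expansion (F : nat -> R -> R) (K : nat) : smooth_seq F -> (1 <= K)%nat ->
  exists C, 0 <= C /\ forall p h y, 0 <= p <= 1 -> 0 < h <= 1 ->
    Rabs (stein (F O) p h y - stein_main F K p h y) <= C * h ^ (K + 2) / (1 + y ^ 2).
Proof.
  intros HF HK.
  destruct (smooth_taylor F K HF HK) as [C0 [HC0 H0]].
  destruct (smooth_taylor F (K + 1) HF ltac:(lia)) as [C1 [HC1 H1]].
  destruct (smooth_taylor F (K + 2) HF ltac:(lia)) as [C2 [HC2 H2]].
  exists (2 * C2 + 2 * C1 + C0); split; [lra|]; intros p h y Hp Hh.
  assert (Habs : forall N, Rabs (- h) ^ N = h ^ N)
    by (intros; rewrite Rabs_Ropp, Rabs_pos_eq by lra; reflexivity).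
  assert (Habs' : forall N, Rabs h ^ N = h ^ N)
    by (intros; rewrite Rabs_pos_eq by lra; reflexivity).
  assert (Hle : Rabs h <= 1) by (rewrite Rabs_pos_eq; lra).
  assert (Hle' : Rabs (- h) <= 1) by (rewrite Rabs_Ropp; exact Hle).
  pose proof (H0 y h Hle) as A0; pose proof (H1 y h Hle) as A1; pose proof (H2 y h Hle) as A2.
  pose proof (H0 y (- h) Hle') as B0; pose proof (H1 y (- h) Hle') as B1;
    pose proof (H2 y (- h) Hle') as B2.
  rewrite Habs' in A0, A1, A2; rewrite Habs in B0, B1, B2.
  unfold stein, stein_main; cbv zeta; fold (y - h) in *.
  (* The [a]'s are the forward remainders and the [b]'s the backward ones; the difference to be
     bounded is linear in them. *)
  set (a0 := F O (y + h) - taylor F K y h) in *.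
  set (a1 := F O (y + h) - taylor F (K + 1) y h) in *.
  set (a2 := F O (y + h) - taylor F (K + 2) y h) in *.
  change (y + - h) with (y - h) in *.
  set (b0 := F O (y - h) - taylor F K y (- h)) in *.
  set (b1 := F O (y - h) - taylor F (K + 1) y (- h)) in *.
  set (b2 := F O (y - h) - taylor F (K + 2) y (- h)) in *.
  match goal with |- Rabs ?e <= _ =>
    replace e with (- (a2 + b2) + y * (h * (p * b1 - (1 - p) * a1))
                    - h ^ 2 * ((p * b0 + (1 - p) * a0) / 2))
      by (unfold a0, a1, a2, b0, b1, b2; field) end.
  set (w := 1 + y ^ 2) in *.
  assert (Hw : 1 <= w) by (unfold w; nra).
  assert (Hyw : Rabs y <= w) by (unfold w, Rabs; destruct Rcase_abs; nra).
  set (z := h ^ K) in *.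
  assert (Hz : 0 < z) by (apply pow_lt; lra).
  rewrite pow_add in A1, A2, B1, B2 |- *; fold z in A1, A2, B1, B2 |- *.
  simpl (h ^ 1) in *; rewrite Rmult_1_r in *.
  set (i := / w).
  assert (Hi : 0 < i <= 1).
  { split; [apply Rinv_0_lt_compat; lra|].
    rewrite <- Rinv_1; apply Rinv_le_contravar; lra. }
  assert (Hwi : w * i = 1) by (apply Rinv_r; lra).
  assert (E : forall C x, C * x / w ^ 2 = C * x * i * i) by (intros; unfold i; field; lra).
  rewrite E in *.
  replace ((2 * C2 + 2 * C1 + C0) * (z * h ^ 2) / w)
    with (2 * (C2 * (z * h ^ 2) * i) + 2 * (C1 * (z * h ^ 2) * i) + C0 * (z * h ^ 2) * i)
    by (unfold i; field; lra).
  assert (G2 : forall t, Rabs t <= C2 * (z * h ^ 2) * i * i -> Rabs t <= C2 * (z * h ^ 2) * i).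
  { intros t Ht; assert (0 <= C2 * (z * h ^ 2) * i) by
      (repeat apply Rmult_le_pos; try lra; apply pow2_ge_0); nra. }
  apply G2 in A2, B2.
  assert (G1 : Rabs (y * (h * (p * b1 - (1 - p) * a1))) <= 2 * (C1 * (z * h ^ 2) * i)).
  { rewrite Rabs_mult, Rabs_mult, (Rabs_pos_eq h) by lra.
    assert (Q : Rabs (p * b1 - (1 - p) * a1) <= 2 * (C1 * (z * h) * i * i)).
    { apply Rabs_le_between in A1, B1; apply Rabs_le_between; nra. }
    replace (2 * (C1 * (z * h ^ 2) * i)) with (w * (h * (2 * (C1 * (z * h) * i * i)))).
    - apply Rmult_le_compat; [apply Rabs_pos | | exact Hyw |].
      + apply Rmult_le_pos; [lra | apply Rabs_pos].
      + apply Rmult_le_compat_l; lra.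
    - transitivity (w * i * (2 * C1 * (z * h ^ 2) * i)); [ring | rewrite Hwi; ring]. }
  assert (G0 : Rabs (h ^ 2 * ((p * b0 + (1 - p) * a0) / 2)) <= C0 * (z * h ^ 2) * i).
  { rewrite Rabs_mult, (Rabs_pos_eq (h ^ 2)) by nra.
    replace (C0 * (z * h ^ 2) * i) with (h ^ 2 * (C0 * z * i)) by ring.
    apply Rmult_le_compat_l; [apply pow2_ge_0|].
    assert (0 <= C0 * z * i * i) by (repeat apply Rmult_le_pos; lra).
    assert (C0 * z * i * i <= C0 * z * i)
      by (assert (0 <= C0 * z * i) by (repeat apply Rmult_le_pos; lra); nra).
    apply Rabs_le_between in A0, B0; apply Rabs_le_between; nra. }
  apply Rabs_le_between in A2, B2, G1, G0; apply Rabs_le_between; lra.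
Qed.

(** * The residual of the expansion *)

Definition edgeworth (p h y : R) : R :=
  Phi0 y + std_normal_density y *
    (P1 p (1 - p) y * h + P2 p (1 - p) y * h ^ 2 + P3 p (1 - p) y * h ^ 3 + P4 p (1 - p) y * h ^ 4).

(* [coefIJ] holds, up to sign and a common denominator, the coefficient of [(pq)^J] in [P_I]. *)
Definition coef10 : list Z := [1; 0; -1]%Z.
Definition coef20 : list Z := [0; -3; 0; 7; 0; -1]%Z.
Definition coef21 : list Z := [0; -3; 0; 11; 0; -2]%Z.
Definition coef30 : list Z := [123; 0; 129; 0; -384; 0; 95; 0; -5]%Z.
Definition coef31 : list Z := [3; 0; 69; 0; -399; 0; 145; 0; -10]%Z.
Definition coef40 : list Z := [0; -4293; 0; -1359; 0; 6165; 0; -1971; 0; 185; 0; -5]%Z.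
Definition coef41 : list Z := [0; 3105; 0; 1395; 0; -7794; 0; 2979; 0; -325; 0; 10]%Z.
Definition coef42 : list Z := [0; 135; 0; -1035; 0; 7947; 0; -4167; 0; 560; 0; -20]%Z.

(** The linear combination is kept apart from the functions, so that it can be applied alike to
    their values, to their images under [stein], to the main parts and to the remainders. *)
Definition edgeworth_sum (p h A B1 B20 B21 B30 B31 B40 B41 B42 : R) : R :=
  A + (1 - 2 * p) / 6 * h * B1
  + h ^ 2 * (/ 72 * B20 - p * (1 - p) / 36 * B21)
  + (1 - 2 * p) * h ^ 3 * (/ 6480 * B30 - p * (1 - p) / 3240 * B31)
  + h ^ 4 * (/ 155520 * B40 + p * (1 - p) / 38880 * B41 + p ^ 2 * (1 - p) ^ 2 / 38880 * B42).

Lemma edgeworth_eq (p h y : R) :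
  edgeworth p h y = edgeworth_sum p h (Phi0 y) (gpoly coef10 y) (gpoly coef20 y) (gpoly coef21 y)
    (gpoly coef30 y) (gpoly coef31 y) (gpoly coef40 y) (gpoly coef41 y) (gpoly coef42 y).
Proof.
  unfold edgeworth, edgeworth_sum, gpoly, P1, P2, P3, P4,
    coef10, coef20, coef21, coef30, coef31, coef40, coef41, coef42; cbn [peval]; field.
Qed.

(** [stein] is linear in [g], and the coefficients of the combination do not depend on y. *)
Lemma stein_edgeworth (p h y : R) :
  stein (edgeworth p h) p h y = edgeworth_sum p h (stein Phi0 p h y)
    (stein (gpoly coef10) p h y) (stein (gpoly coef20) p h y) (stein (gpoly coef21) p h y)
    (stein (gpoly coef30) p h y) (stein (gpoly coef31) p h y) (stein (gpoly coef40) p h y)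
    (stein (gpoly coef41) p h y) (stein (gpoly coef42) p h y).
Proof.
  unfold stein; rewrite !edgeworth_eq; unfold edgeworth_sum; field.
Qed.

(* This identity determines [P1, ..., P4]. *)
Lemma stein_main_edgeworth (p h y : R) :
  edgeworth_sum p h (stein_main Phi_seq 5 p h y)
    (stein_main (gpoly_seq coef10) 4 p h y)
    (stein_main (gpoly_seq coef20) 3 p h y) (stein_main (gpoly_seq coef21) 3 p h y)
    (stein_main (gpoly_seq coef30) 2 p h y) (stein_main (gpoly_seq coef31) 2 p h y)
    (stein_main (gpoly_seq coef40) 1 p h y) (stein_main (gpoly_seq coef41) 1 p h y)
    (stein_main (gpoly_seq coef42) 1 p h y) = 0.
Proof.
  unfold edgeworth_sum, stein_main, taylor; cbn [psum Nat.add Phi_seq].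
  assert (F2 : INR (fact 2) = 2) by (simpl; ring).
  assert (F3 : INR (fact 3) = 6) by (simpl; ring).
  assert (F4 : INR (fact 4) = 24) by (rewrite INR_IZR_INZ; reflexivity).
  assert (F5 : INR (fact 5) = 120) by (rewrite INR_IZR_INZ; reflexivity).
  assert (F6 : INR (fact 6) = 720) by (rewrite INR_IZR_INZ; reflexivity).
  rewrite F2, F3, F4, F5, F6; change (INR (fact 1)) with 1; change (INR (fact 0)) with 1.
  unfold gpoly_seq, gpoly.
  (* All derivatives of the coefficient lists are computed explicitly. *)
  repeat match goal with |- context [Nat.iter ?m gauss_deriv ?l] =>
    let v := eval vm_compute in (Nat.iter m gauss_deriv l) in
    change (Nat.iter m gauss_deriv l) with v end.
  cbn [peval].
  (* With the density and [Phi0 y] as indeterminates, a polynomial identity in p, h and y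
     remains. *)
  generalize (std_normal_density y) (Phi0 y); intros f P; clear.
  field.
Qed.

(** The powers of h in the combination complete every bound to h^4 E, and the numerical weights are
    at most 1 in absolute value. It serves with E = h^3/(1 + y^2) for the residual and with E = (1 +
    y^2)^(-3)/h^4 for the decay of the corrections. *)
Lemma edgeworth_sum_bound (p h A B1 B20 B21 B30 B31 B40 B41 B42 E X : R)
    (C0 C1 C20 C21 C30 C31 C40 C41 C42 : R) :
  0 <= p <= 1 -> 0 < h <= 1 -> 0 <= E ->
  Rabs A <= C0 * (h ^ 4 * E) -> Rabs B1 <= C1 * (h ^ 3 * E) ->
  Rabs B20 <= C20 * (h ^ 2 * E) -> Rabs B21 <= C21 * (h ^ 2 * E) ->
  Rabs B30 <= C30 * (h * E) -> Rabs B31 <= C31 * (h * E) ->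
  Rabs B40 <= C40 * E -> Rabs B41 <= C41 * E -> Rabs B42 <= C42 * E ->
  Rabs (edgeworth_sum p h A B1 B20 B21 B30 B31 B40 B41 B42)
  <= (C0 + C1 + C20 + C21 + C30 + C31 + C40 + C41 + C42) * (h ^ 4 * E).
Proof.
  intros Hp Hh HE HA H1 H20 H21 H30 H31 H40 H41 H42.
  assert (Hpq : 0 <= p * (1 - p) <= 1) by nra.
  assert (Hpq2 : 0 <= p ^ 2 * (1 - p) ^ 2 <= 1).
  { replace (p ^ 2 * (1 - p) ^ 2) with ((p * (1 - p)) * (p * (1 - p))) by ring; nra. }
  assert (S : forall w b k x, Rabs w <= 1 -> Rabs b <= k * x -> forall i, 0 <= i ->
    i * x = h ^ 4 * E -> Rabs (w * (i * b)) <= k * (h ^ 4 * E)).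
  { intros w b k x Hw Hb i Hi Hix.
    rewrite !Rabs_mult, (Rabs_pos_eq i) by exact Hi.
    replace (k * (h ^ 4 * E)) with (1 * (i * (k * x))) by (rewrite <- Hix; ring).
    apply Rmult_le_compat; [apply Rabs_pos | | exact Hw |].
    - apply Rmult_le_pos; [exact Hi | apply Rabs_pos].
    - apply Rmult_le_compat_l; assumption. }
  assert (T1 : Rabs ((1 - 2 * p) / 6 * (h * B1)) <= C1 * (h ^ 4 * E)).
  { eapply S; [apply Rabs_le_between; lra | exact H1 | lra | ring]. }
  assert (T20 : Rabs (/ 72 * (h ^ 2 * B20)) <= C20 * (h ^ 4 * E)).
  { eapply S; [apply Rabs_le_between; lra | exact H20 | nra | ring]. }
  assert (T21 : Rabs (- (p * (1 - p) / 36) * (h ^ 2 * B21)) <= C21 * (h ^ 4 * E)).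
  { eapply S; [apply Rabs_le_between; lra | exact H21 | nra | ring]. }
  assert (Hh3 : 0 <= h ^ 3) by (apply pow_le; lra).
  assert (Hh4 : 0 <= h ^ 4) by (apply pow_le; lra).
  assert (T30 : Rabs ((1 - 2 * p) / 6480 * (h ^ 3 * B30)) <= C30 * (h ^ 4 * E)).
  { eapply S; [apply Rabs_le_between; lra | exact H30 | lra | ring]. }
  assert (T31 : Rabs (- ((1 - 2 * p) * (p * (1 - p)) / 3240) * (h ^ 3 * B31)) <= C31 * (h ^ 4 * E)).
  { eapply S; [apply Rabs_le_between; nra | exact H31 | lra | ring]. }
  assert (T40 : Rabs (/ 155520 * (h ^ 4 * B40)) <= C40 * (h ^ 4 * E)).
  { eapply S; [apply Rabs_le_between; lra | exact H40 | lra | ring]. }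
  assert (T41 : Rabs (p * (1 - p) / 38880 * (h ^ 4 * B41)) <= C41 * (h ^ 4 * E)).
  { eapply S; [apply Rabs_le_between; lra | exact H41 | lra | ring]. }
  assert (T42 : Rabs (p ^ 2 * (1 - p) ^ 2 / 38880 * (h ^ 4 * B42)) <= C42 * (h ^ 4 * E)).
  { eapply S; [apply Rabs_le_between; lra | exact H42 | lra | ring]. }
  clear - HA T1 T20 T21 T30 T31 T40 T41 T42.
  replace (edgeworth_sum p h A B1 B20 B21 B30 B31 B40 B41 B42) with
    (A + (1 - 2 * p) / 6 * (h * B1) + / 72 * (h ^ 2 * B20)
     + - (p * (1 - p) / 36) * (h ^ 2 * B21) + (1 - 2 * p) / 6480 * (h ^ 3 * B30)
     + - ((1 - 2 * p) * (p * (1 - p)) / 3240) * (h ^ 3 * B31) + / 155520 * (h ^ 4 * B40)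
     + p * (1 - p) / 38880 * (h ^ 4 * B41) + p ^ 2 * (1 - p) ^ 2 / 38880 * (h ^ 4 * B42))
    by (unfold edgeworth_sum; field).
  rewrite !Rmult_plus_distr_r.
  repeat (eapply Rle_trans; [apply Rabs_triang|]; apply Rplus_le_compat; [|assumption]).
  assumption.
Qed.

(** A term carrying h^i is expanded with K = 5 - i, so all remainders have order h^7, while the main
    parts cancel by [stein_main_edgeworth]. *)
Lemma stein_edgeworth_bound : exists C, 0 <= C /\
  forall p h y, 0 <= p <= 1 -> 0 < h <= 1 ->
    Rabs (stein (edgeworth p h) p h y) <= C * h ^ 7 / (1 + y ^ 2).
Proof.
  destruct (stein_expansion _ 5 smooth_Phi_seq ltac:(lia)) as [C0 [P0 H0]].
  destruct (stein_expansion _ 4 (smooth_gpoly_seq coef10) ltac:(lia)) as [C1 [P1 H1]].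
  destruct (stein_expansion _ 3 (smooth_gpoly_seq coef20) ltac:(lia)) as [C20 [P20 H20]].
  destruct (stein_expansion _ 3 (smooth_gpoly_seq coef21) ltac:(lia)) as [C21 [P21 H21]].
  destruct (stein_expansion _ 2 (smooth_gpoly_seq coef30) ltac:(lia)) as [C30 [P30 H30]].
  destruct (stein_expansion _ 2 (smooth_gpoly_seq coef31) ltac:(lia)) as [C31 [P31 H31]].
  destruct (stein_expansion _ 1 (smooth_gpoly_seq coef40) ltac:(lia)) as [C40 [P40 H40]].
  destruct (stein_expansion _ 1 (smooth_gpoly_seq coef41) ltac:(lia)) as [C41 [P41 H41]].
  destruct (stein_expansion _ 1 (smooth_gpoly_seq coef42) ltac:(lia)) as [C42 [P42 H42]].
  exists (C0 + C1 + C20 + C21 + C30 + C31 + C40 + C41 + C42); split; [lra|].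
  intros p h y Hp Hh.
  rewrite stein_edgeworth.
  match goal with |- Rabs ?e <= _ =>
    replace e with (e - 0) by ring; rewrite <- (stein_main_edgeworth p h y) end.
  specialize (H0 p h y Hp Hh); specialize (H1 p h y Hp Hh).
  specialize (H20 p h y Hp Hh); specialize (H21 p h y Hp Hh).
  specialize (H30 p h y Hp Hh); specialize (H31 p h y Hp Hh).
  specialize (H40 p h y Hp Hh); specialize (H41 p h y Hp Hh); specialize (H42 p h y Hp Hh).
  cbn [Nat.add] in *.
  change (gpoly_seq ?l 0) with (gpoly l) in *; change (Phi_seq 0) with Phi0 in *.
  match goal with |- Rabs (edgeworth_sum _ _ ?a0 ?a1 ?a2 ?a3 ?a4 ?a5 ?a6 ?a7 ?a8
                           - edgeworth_sum _ _ ?b0 ?b1 ?b2 ?b3 ?b4 ?b5 ?b6 ?b7 ?b8) <= _ =>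
    replace (edgeworth_sum p h a0 a1 a2 a3 a4 a5 a6 a7 a8
             - edgeworth_sum p h b0 b1 b2 b3 b4 b5 b6 b7 b8)
      with (edgeworth_sum p h (a0 - b0) (a1 - b1) (a2 - b2) (a3 - b3) (a4 - b4)
              (a5 - b5) (a6 - b6) (a7 - b7) (a8 - b8)) by (unfold edgeworth_sum; ring) end.
  assert (Hy : 0 < / (1 + y ^ 2)) by (apply Rinv_0_lt_compat; nra).
  match goal with |- _ <= ?C * _ / _ =>
    replace (C * h ^ 7 / (1 + y ^ 2)) with (C * (h ^ 4 * (h ^ 3 * / (1 + y ^ 2))))
      by (unfold Rdiv; ring) end.
  assert (Hh3 : 0 <= h ^ 3) by (apply pow_le; lra).
  apply edgeworth_sum_bound; try assumption; try (apply Rmult_le_pos; lra);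
    (eapply Rle_trans; [eassumption | right; unfold Rdiv; ring]).
Qed.

Lemma edgeworth_sub_Phi0_bound : exists C, 0 <= C /\
  forall p h y, 0 <= p <= 1 -> 0 < h <= 1 ->
    Rabs (edgeworth p h y - Phi0 y) <= C / (1 + y ^ 2) ^ 3.
Proof.
  destruct (gpoly_decay coef10 3) as [C1 [P1 H1]].
  destruct (gpoly_decay coef20 3) as [C20 [P20 H20]].
  destruct (gpoly_decay coef21 3) as [C21 [P21 H21]].
  destruct (gpoly_decay coef30 3) as [C30 [P30 H30]].
  destruct (gpoly_decay coef31 3) as [C31 [P31 H31]].
  destruct (gpoly_decay coef40 3) as [C40 [P40 H40]].
  destruct (gpoly_decay coef41 3) as [C41 [P41 H41]].
  destruct (gpoly_decay coef42 3) as [C42 [P42 H42]].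
  exists (0 + C1 + C20 + C21 + C30 + C31 + C40 + C41 + C42); split; [lra|].
  intros p h y Hp Hh.
  rewrite edgeworth_eq.
  match goal with |- Rabs (edgeworth_sum _ _ ?a0 ?a1 ?a2 ?a3 ?a4 ?a5 ?a6 ?a7 ?a8 - _) <= _ =>
    replace (edgeworth_sum p h a0 a1 a2 a3 a4 a5 a6 a7 a8 - Phi0 y)
      with (edgeworth_sum p h 0 a1 a2 a3 a4 a5 a6 a7 a8) by (unfold edgeworth_sum; ring) end.
  set (e := / (1 + y ^ 2) ^ 3).
  assert (He : 0 < e) by (apply Rinv_0_lt_compat, pow_lt; nra).
  assert (Hk : forall k, 0 < h ^ k) by (intros; apply pow_lt; lra).
  pose proof (Hk 4%nat) as Hh4.
  unfold Rdiv; fold e; replace e with (h ^ 4 * (e / h ^ 4)) by (field; lra).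
  (* Since h <= 1, inserting h^k / h^4 >= 1 only weakens the decay bounds and gives them the shape
     that [edgeworth_sum_bound] takes. *)
  assert (W : forall l C k, (k <= 4)%nat -> 0 <= C -> Rabs (gpoly l y) <= C / (1 + y ^ 2) ^ 3 ->
    Rabs (gpoly l y) <= C * (h ^ k * (e / h ^ 4))).
  { intros l C k Hk4 HC H; eapply Rle_trans; [exact H|].
    apply Rmult_le_compat_l; [exact HC|]; fold e.
    replace 4%nat with (k + (4 - k))%nat by lia; rewrite pow_add.
    replace (h ^ k * (e / (h ^ k * h ^ (4 - k)))) with (e * / h ^ (4 - k))
      by (field; split; apply Rgt_not_eq, Hk).
    rewrite <- (Rmult_1_r e) at 1; apply Rmult_le_compat_l; [lra|].
    rewrite <- Rinv_1; apply Rinv_le_contravar; [apply Hk|].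
    rewrite <- (pow1 (4 - k)); apply pow_incr; lra. }
  pose proof (W coef10 C1 3%nat ltac:(lia) P1 (H1 y)) as W1.
  pose proof (W coef20 C20 2%nat ltac:(lia) P20 (H20 y)) as W20.
  pose proof (W coef21 C21 2%nat ltac:(lia) P21 (H21 y)) as W21.
  pose proof (W coef30 C30 1%nat ltac:(lia) P30 (H30 y)) as W30.
  pose proof (W coef31 C31 1%nat ltac:(lia) P31 (H31 y)) as W31.
  pose proof (W coef40 C40 0%nat ltac:(lia) P40 (H40 y)) as W40.
  pose proof (W coef41 C41 0%nat ltac:(lia) P41 (H41 y)) as W41.
  pose proof (W coef42 C42 0%nat ltac:(lia) P42 (H42 y)) as W42.
  rewrite pow_1 in W30, W31; rewrite pow_O, Rmult_1_l in W40, W41, W42.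
  apply edgeworth_sum_bound; try assumption.
  - left; apply Rdiv_lt_0_compat; assumption.
  - rewrite Rabs_R0; lra.
Qed.

Lemma exp_le_inv_cube : exists C, 0 <= C /\ forall y, exp (- y ^ 2 / 2) <= C / (1 + y ^ 2) ^ 3.
Proof.
  destruct (exp_dominates_pow 3) as [C HC]; exists C; split.
  - eapply Rle_trans; [|apply (HC 0); lra].
    apply Rmult_le_pos; [left; apply exp_pos | apply pow_le; lra].
  - intros y; assert (Hy : (1 + y ^ 2) ^ 3 > 0) by (apply pow_lt; nra).
    apply (proj1 (Rle_div_r _ _ _ Hy)), HC; nra.
Qed.

(** For y >= 1/h the decay (1 + y^2)^(-3) is at most h^6. Both ends of the lattice lie this far
    out. *)
Lemma edgeworth_tails : exists C, 0 <= C /\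
  forall p h y, 0 <= p <= 1 -> 0 < h <= 1 -> / h <= y ->
    Rabs (1 - edgeworth p h y) <= C * h ^ 5 /\ Rabs (edgeworth p h (- y)) <= C * h ^ 5.
Proof.
  destruct edgeworth_sub_Phi0_bound as [C [HC H]], exp_le_inv_cube as [C' [HC' H']].
  exists (C + C'); split; [lra|]; intros p h y Hp Hh Hy.
  assert (Hi : 0 < / h) by (apply Rinv_0_lt_compat; lra).
  assert (Hw : / (1 + y ^ 2) ^ 3 <= h ^ 5).
  { apply Rle_trans with (h ^ 6).
    - replace (h ^ 6) with (/ ((/ h) ^ 2) ^ 3) by (field; lra).
      apply Rinv_le_contravar; [apply pow_lt; nra|].
      apply pow_incr; nra.
    - replace (h ^ 6) with (h ^ 5 * h) by ring.
      assert (0 < h ^ 5) by (apply pow_lt; lra); nra. }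
  pose proof (H p h y Hp Hh) as A; pose proof (H p h (- y) Hp Hh) as B.
  pose proof (H' y) as E; pose proof (Phi0_tail y ltac:(lra)) as F.
  rewrite Phi0_opp in B; replace ((- y) ^ 2) with (y ^ 2) in B by ring.
  assert (G : C / (1 + y ^ 2) ^ 3 <= C * h ^ 5) by (apply Rmult_le_compat_l; assumption).
  assert (G' : C' / (1 + y ^ 2) ^ 3 <= C' * h ^ 5) by (apply Rmult_le_compat_l; assumption).
  rewrite Rmult_plus_distr_r.
  apply Rabs_le_between in A, B, F.
  split; apply Rabs_le_between; lra.
Qed.

(** * The binomial distribution *)

Lemma psum_le (f g : nat -> R) (n : nat) :
  (forall k, (k < n)%nat -> f k <= g k) -> psum f n <= psum g n.
Proof.
  induction n as [|n IH]; intros H; simpl; [lra|].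
  apply Rplus_le_compat; [apply IH; intros; apply H; lia | apply H; lia].
Qed.

Lemma psum_ext (f g : nat -> R) (n : nat) :
  (forall k, (k < n)%nat -> f k = g k) -> psum f n = psum g n.
Proof.
  intros H; apply Rle_antisym; apply psum_le; intros; right; [|symmetry]; auto.
Qed.

Lemma psum_lin (a b : R) (f g : nat -> R) (n : nat) :
  psum (fun k => a * f k + b * g k) n = a * psum f n + b * psum g n.
Proof. induction n as [|n IH]; simpl; [|rewrite IH]; ring. Qed.

Lemma psum_telescope (f : nat -> R) (n : nat) : psum (fun k => f (S k) - f k) n = f n - f O.
Proof. induction n as [|n IH]; simpl; [|rewrite IH]; ring. Qed.

Lemma sum_f_R0_psum (f : nat -> R) (n : nat) : sum_f_R0 f n = psum f (S n).
Proof. induction n as [|n IH]; simpl in *; [|rewrite IH]; ring. Qed.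

(* Each summand is at most three times the increment of [atan], and [3 PI < 12]. *)
Lemma cauchy_sum_bound (a h : R) (n : nat) : 0 < h <= 1 ->
  psum (fun k => h / (1 + (a + INR k * h) ^ 2)) n <= 12.
Proof.
  intros Hh.
  apply Rle_trans with (psum (fun k => 3 * atan (a + INR (S k) * h) - 3 * atan (a + INR k * h)) n).
  - apply psum_le; intros k _.
    set (y := a + INR k * h).
    replace (a + INR (S k) * h) with (y + h) by (unfold y; rewrite S_INR; ring).
    destruct (MVT_gen atan y (y + h) (fun t => / (1 + t ^ 2))) as [c [Hc Hct]].
    + intros t _; apply is_derive_Reals, derivable_pt_lim_atan.
    + intros t _; apply derivable_continuous_pt; eexists; apply derivable_pt_lim_atan.
    + rewrite Rmin_left, Rmax_right in Hc by lra.
      replace (3 * atan (y + h) - 3 * atan y) with (h * (3 * / (1 + c ^ 2))) by lra.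
      apply Rmult_le_compat_l; [lra|].
      assert (0 <= (c - y) ^ 2 <= 1) by nra.
      replace (3 * / (1 + c ^ 2)) with (/ ((1 + c ^ 2) / 3)) by (field; nra).
      apply Rinv_le_contravar; [nra|].
      pose proof (pow2_ge_0 (c - 2 * y)); nra.
  - rewrite (psum_telescope (fun k => 3 * atan (a + INR k * h))).
    pose proof (atan_bound (a + INR n * h)); pose proof (atan_bound (a + INR 0 * h)).
    pose proof PI_4; lra.
Qed.

(** * Binomial probabilities and their flow *)

Definition bpmf (n : nat) (p : R) (k : nat) : R := Binomial.C n k * p ^ k * (1 - p) ^ (n - k).

Definition bcdf (n : nat) (p : R) (k : nat) : R := psum (bpmf n p) (S k).

(* Mass flowing from [k] to [k+1] in the birth-death chain reversible for the binomial law. *)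
Definition flow (n : nat) (p : R) (k : nat) : R := (INR n - INR k) * p * bpmf n p k.

(** For k > n truncated subtraction gives the default value n!/k! p^k, which is positive as well. *)
Lemma bpmf_pos (n k : nat) (p : R) : 0 < p < 1 -> 0 < bpmf n p k.
Proof.
  intros Hp; unfold bpmf, Binomial.C.
  repeat apply Rmult_lt_0_compat; try (apply pow_lt; lra); try apply INR_fact_lt_0.
  apply Rinv_0_lt_compat, Rmult_lt_0_compat; apply INR_fact_lt_0.
Qed.

(** Detailed balance, from (n - k) C(n,k) = (k + 1) C(n,k+1). *)
Lemma flow_balance (n k : nat) (p : R) : (k < n)%nat ->
  flow n p k = (INR k + 1) * (1 - p) * bpmf n p (S k).
Proof.
  intros Hk; unfold flow, bpmf, Binomial.C.
  replace (n - k)%nat with (S (n - S k)) by lia.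
  change (fact (S k)) with (S k * fact k)%nat.
  change (fact (S (n - S k))) with (S (n - S k) * fact (n - S k))%nat.
  rewrite !mult_INR, (S_INR (n - S k)), minus_INR, (S_INR k) by lia.
  pose proof (INR_fact_neq_0 k); pose proof (INR_fact_neq_0 (n - S k)).
  assert (INR k < INR n) by (apply lt_INR, Hk); pose proof (pos_INR k).
  simpl pow; field; repeat split; try assumption; lra.
Qed.

Lemma flow_top (n : nat) (p : R) : flow n p n = 0.
Proof. unfold flow; ring. Qed.

Lemma flow_0 (n : nat) (p : R) : flow n p 0 = INR n * p * bpmf n p 0.
Proof. unfold flow; simpl; ring. Qed.

Lemma flow_S (n k : nat) (p : R) : (k < n)%nat ->
  flow n p (S k) = flow n p k + (INR n * p - (INR k + 1)) * bpmf n p (S k).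
Proof. intros Hk; rewrite (flow_balance n k p Hk); unfold flow; rewrite S_INR; ring. Qed.

Lemma bcdf_top (n : nat) (p : R) : bcdf n p n = 1.
Proof.
  unfold bcdf; rewrite <- sum_f_R0_psum.
  transitivity ((p + (1 - p)) ^ n); [symmetry; apply binomial|].
  replace (p + (1 - p)) with 1 by ring; apply pow1.
Qed.

Lemma bcdf_S (n k : nat) (p : R) : bcdf n p (S k) = bcdf n p k + bpmf n p (S k).
Proof. reflexivity. Qed.

Lemma bcdf_0 (n : nat) (p : R) : bcdf n p 0 = bpmf n p 0.
Proof. unfold bcdf; simpl; ring. Qed.

Lemma bcdf_mono (n k m : nat) (p : R) : 0 < p < 1 -> (k <= m)%nat -> bcdf n p k <= bcdf n p m.
Proof.
  intros Hp; induction 1 as [|m _ IH]; [lra|].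
  rewrite bcdf_S; pose proof (bpmf_pos n (S m) p Hp); lra.
Qed.

Lemma bcdf_bounds (n k : nat) (p : R) : 0 < p < 1 -> (k <= n)%nat -> 0 < bcdf n p k <= 1.
Proof.
  intros Hp Hk; split.
  - apply Rlt_le_trans with (bcdf n p 0); [rewrite bcdf_0; apply bpmf_pos, Hp|].
    apply bcdf_mono; [exact Hp | lia].
  - rewrite <- (bcdf_top n p); apply bcdf_mono; assumption.
Qed.

(** The flow at k is the sum of (np - i) b(i) over i <= k, and np - i >= np - k there. *)
Lemma flow_ge_left (n k : nat) (p : R) : 0 < p < 1 -> (k <= n)%nat ->
  (INR n * p - INR k) * bcdf n p k <= flow n p k.
Proof.
  intros Hp; induction k as [|k IH]; intros Hk.
  - rewrite flow_0, bcdf_0; simpl; lra.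
  - rewrite flow_S, bcdf_S, S_INR by lia.
    specialize (IH ltac:(lia)); pose proof (bcdf_bounds n k p Hp ltac:(lia)); nra.
Qed.

(** The decrease is the sum of (i - np) b(i) over k < i <= m, where i - np >= k - np. *)
Lemma flow_decr (n k m : nat) (p : R) : 0 < p < 1 -> (k <= m)%nat -> (m <= n)%nat ->
  (INR k - INR n * p) * (bcdf n p m - bcdf n p k) <= flow n p k - flow n p m.
Proof.
  intros Hp Hkm; induction Hkm as [|m Hkm IH]; intros Hm; [lra|].
  rewrite flow_S, bcdf_S by lia; specialize (IH ltac:(lia)).
  apply le_INR in Hkm; pose proof (bpmf_pos n (S m) p Hp); nra.
Qed.

Lemma flow_ge_right (n k : nat) (p : R) : 0 < p < 1 -> (k <= n)%nat ->
  (INR k - INR n * p) * (1 - bcdf n p k) <= flow n p k.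
Proof.
  intros Hp Hk; pose proof (flow_decr n k n p Hp Hk ltac:(lia)) as H.
  rewrite flow_top, bcdf_top in H; lra.
Qed.

(* The flow is unimodal with peak at the mean. *)
Lemma flow_le (n k m : nat) (p M : R) : 0 < p < 1 -> (k <= n)%nat -> (m <= n)%nat ->
  Rabs (INR m - INR n * p) <= M -> flow n p k <= flow n p m + M.
Proof.
  intros Hp Hk Hm HM.
  assert (HM0 : 0 <= M) by (eapply Rle_trans; [apply Rabs_pos | exact HM]).
  apply Rabs_le_between in HM.
  pose proof (bcdf_bounds n k p Hp Hk) as Bk; pose proof (bcdf_bounds n m p Hp Hm) as Bm.
  (* On either side, the excess of the flow at k over that at m is at most M times the mass between
     the two points. *)
  destruct (Nat.le_gt_cases m k) as [Hmk|Hkm].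
  - assert (H : flow n p k - flow n p m <= M * (bcdf n p k - bcdf n p m)); [|nra].
    pose proof (flow_decr n m k p Hp Hmk Hk).
    pose proof (bcdf_mono n m k p Hp Hmk); nra.
  - assert (H : forall i, (k <= i)%nat -> (i <= m)%nat ->
      flow n p k - flow n p i <= M * (bcdf n p i - bcdf n p k)).
    { intros i Hi; induction Hi as [|i Hi IH]; intros Him; [lra|].
      rewrite flow_S, bcdf_S by lia; specialize (IH ltac:(lia)).
      assert (INR i + 1 <= INR m) by (rewrite <- S_INR; apply le_INR, Him).
      pose proof (bpmf_pos n (S i) p Hp); nra. }
    specialize (H m ltac:(lia) ltac:(lia)); nra.
Qed.

Lemma psum_centered (n k : nat) (p : R) : (k <= n)%nat ->
  psum (fun i => (INR n * p - INR i) * bpmf n p i) (S k) = flow n p k.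
Proof.
  induction k as [|k IH]; intros Hk.
  - rewrite flow_0; simpl; ring.
  - change (psum ?f (S (S k))) with (psum f (S k) + f (S k)); cbv beta.
    rewrite IH, flow_S, S_INR by lia; ring.
Qed.

(** Summation by parts: (i - np) b(i) is minus the increment of the flow at i. *)
Lemma psum_centered_sq (n k : nat) (p : R) : (k <= n)%nat ->
  psum (fun i => (INR i - INR n * p) ^ 2 * bpmf n p i) (S k)
  = psum (flow n p) k - (INR k - INR n * p) * flow n p k.
Proof.
  induction k as [|k IH]; intros Hk.
  - rewrite flow_0; simpl; ring.
  - change (psum ?f (S (S k))) with (psum f (S k) + f (S k)); cbv beta.
    rewrite IH, flow_S, S_INR by lia; simpl; ring.
Qed.

(** At k = n the boundary term vanishes, so the variance is the total flow np - p E, where E is the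
    mean; [psum_centered] at n gives E = np. *)
Lemma binomial_variance (n : nat) (p : R) :
  psum (fun i => (INR i - INR n * p) ^ 2 * bpmf n p i) (S n) = INR n * p * (1 - p).
Proof.
  rewrite psum_centered_sq, flow_top by lia.
  pose proof (psum_centered n n p (Nat.le_refl n)) as Hm.
  rewrite flow_top in Hm.
  rewrite (psum_ext _ (fun i => INR n * p * bpmf n p i + (- 1) * (INR i * bpmf n p i))) in Hm
    by (intros; ring).
  rewrite psum_lin in Hm.
  assert (Hf : psum (flow n p) (S n)
    = INR n * p * psum (bpmf n p) (S n) + (- p) * psum (fun i => INR i * bpmf n p i) (S n)).
  { rewrite <- psum_lin; apply psum_ext; intros; unfold flow; ring. }
  simpl psum at 1 in Hf; rewrite flow_top in Hf.
  change (psum (bpmf n p) (S n)) with (bcdf n p n) in Hf, Hm; rewrite bcdf_top in Hf, Hm.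
  nra.
Qed.

(* By Chebyshev three quarters of the mass lie within [2 s] of the mean, where
   [bpmf k <= 2 flow k / s^2], so the largest value of the flow is at least of order [s]. *)
Lemma flow_sup_ge (n : nat) (p s M : R) : 0 < p < 1 -> 4 <= s ->
  s ^ 2 = INR n * p * (1 - p) -> (forall k, (k <= n)%nat -> flow n p k <= M) -> s / 160 <= M.
Proof.
  intros Hp Hs HV HM.
  assert (HM0 : 0 <= M) by (rewrite <- (flow_top n p); apply HM; lia).
  (* Cauchy weights of total at most 12 replace a count of the lattice points within 2 s of the
     mean. *)
  set (w := fun k => / s / (1 + ((- INR n * p * / s) + INR k * / s) ^ 2)).
  assert (His : 0 < / s <= 1).
  { split; [apply Rinv_0_lt_compat; lra|].
    rewrite <- Rinv_1; apply Rinv_le_contravar; lra. }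
  assert (Hb : forall k, (k < S n)%nat ->
    bpmf n p k <= / (4 * s ^ 2) * ((INR k - INR n * p) ^ 2 * bpmf n p k) + 10 * M / s * w k).
  { intros k Hk.
    pose proof (bpmf_pos n k p Hp) as Hbk.
    set (x := - INR n * p * / s + INR k * / s).
    assert (Hx : INR k - INR n * p = s * x) by (unfold x; field; lra).
    assert (Hw : w k = / s / (1 + x ^ 2)) by reflexivity.
    assert (Hwp : 0 < w k) by (rewrite Hw; apply Rdiv_lt_0_compat; nra).
    assert (H10 : 0 <= 10 * M / s) by (apply Rmult_le_pos; lra).
    rewrite Hx.
    replace (/ (4 * s ^ 2) * ((s * x) ^ 2 * bpmf n p k)) with (x ^ 2 / 4 * bpmf n p k)
      by (field; lra).
    (* Outside the window the variance term alone suffices; inside, w >= 1/(5 s) and b <= 2 M /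
       s^2. *)
    destruct (Rle_lt_dec 4 (x ^ 2)) as [Hx4|Hx4].
    - assert (0 <= 10 * M / s * w k) by (apply Rmult_le_pos; lra). nra.
    - assert (Hfl : s ^ 2 / 2 * bpmf n p k <= M).
      { eapply Rle_trans; [|apply (HM k); lia]; unfold flow.
        apply Rmult_le_compat_r; [lra|].
        assert (Hx2 : x <= 2) by nra.
        assert (Hsx : s * x <= 2 * s) by nra.
        assert (2 * s <= s ^ 2 / 2) by nra.
        assert (p * (s * x) <= 2 * s) by nra.
        replace ((INR n - INR k) * p) with (s ^ 2 - p * (s * x)) by (rewrite HV, <- Hx; ring).
        lra. }
      assert (Hw5 : / s / 5 <= w k).
      { rewrite Hw; apply Rmult_le_compat_l; [lra|]; apply Rinv_le_contravar; nra. }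
      assert (0 <= x ^ 2 / 4 * bpmf n p k) by (apply Rmult_le_pos; nra).
      apply Rle_trans with (10 * M / s * (/ s / 5)).
      + replace (10 * M / s * (/ s / 5)) with (M / (s ^ 2 / 2)) by (field; lra).
        assert (Hs2 : s ^ 2 / 2 > 0) by nra.
        apply (proj1 (Rle_div_r _ _ _ Hs2)); lra.
      + apply Rle_trans with (10 * M / s * w k); [apply Rmult_le_compat_l; assumption | lra]. }
  apply psum_le in Hb.
  rewrite psum_lin, binomial_variance, <- HV in Hb.
  change (psum (fun k => bpmf n p k) (S n)) with (bcdf n p n) in Hb.
  change (psum (bpmf n p) (S n)) with (bcdf n p n) in Hb.
  rewrite bcdf_top in Hb.
  assert (Hws : psum w (S n) <= 12) by (apply cauchy_sum_bound, His).
  assert (H10 : 0 <= 10 * M / s) by (apply Rmult_le_pos; lra).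
  assert (Hq : / (4 * s ^ 2) * s ^ 2 = / 4) by (field; lra).
  (* Summing over all k gives 1 <= 1/4 + 12 (10 M / s). *)
  assert (H1 : 3 / 4 <= 120 * M / s).
  { apply Rle_trans with (10 * M / s * 12); [|right; field; lra].
    apply Rle_trans with (10 * M / s * psum w (S n)); [|apply Rmult_le_compat_l; assumption].
    change (psum (fun k => w k) (S n)) with (psum w (S n)) in Hb; lra. }
  assert (Hsp : s > 0) by lra.
  apply (proj2 (Rle_div_r _ _ _ Hsp)) in H1; lra.
Qed.

(* Equivalently, the solution of the binomial Stein equation for a half-line is O(1/s). *)
Lemma bcdf_var_le_flow (n k : nat) (p s : R) : 0 < p < 1 -> 4 <= s ->
  s ^ 2 = INR n * p * (1 - p) -> (k <= n)%nat ->
  bcdf n p k * (1 - bcdf n p k) * (s / 320) <= flow n p k.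
Proof.
  intros Hp Hs HV Hk.
  pose proof (bcdf_bounds n k p Hp Hk) as HF.
  (* Within s/320 of the mean the flow is at least s/160 - s/320. Farther out, the one-sided bounds
     give s/320 times F or 1 - F. *)
  destruct (Rle_lt_dec (Rabs (INR k - INR n * p)) (s / 320)) as [Hc|Hc].
  - assert (H : s / 160 <= flow n p k + s / 320).
    { apply (flow_sup_ge n p s); try assumption.
      intros i Hi; apply flow_le; assumption. }
    assert (bcdf n p k * (1 - bcdf n p k) <= 1) by nra. nra.
  - pose proof (flow_ge_left n k p Hp Hk); pose proof (flow_ge_right n k p Hp Hk).
    unfold Rabs in Hc; destruct Rcase_abs.
    + apply Rle_trans with ((INR n * p - INR k) * bcdf n p k); [|assumption].
      rewrite (Rmult_comm (INR n * p - INR k)), Rmult_assoc.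
      apply Rmult_le_compat_l; nra.
    + apply Rle_trans with ((INR k - INR n * p) * (1 - bcdf n p k)); [|assumption].
      replace (bcdf n p k * (1 - bcdf n p k) * (s / 320))
        with (bcdf n p k * (s / 320) * (1 - bcdf n p k)) by ring.
      apply Rmult_le_compat_r; nra.
Qed.

(** With A the partial sums of b d, the left side is (1 - F(j)) A(j) - F(j) (A(n) - A(j)). Both
    pieces are summed by parts; their d(j) terms cancel. Monotonicity of F turns the outer weights
    into 1 - F(k) for k < j and F(k) for k >= j. *)
Lemma abel_cdf_bound (n j : nat) (p : R) (d : nat -> R) : 0 < p < 1 -> (j <= n)%nat ->
  Rabs (psum (fun k => bpmf n p k * d k) (S j)
        - bcdf n p j * psum (fun k => bpmf n p k * d k) (S n))
  <= psum (fun k => bcdf n p k * (1 - bcdf n p k) * Rabs (d k - d (S k))) n.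
Proof.
  intros Hp Hj.
  set (A := fun k => psum (fun k => bpmf n p k * d k) (S k)).
  set (W := psum (fun k => bcdf n p k * (1 - bcdf n p k) * Rabs (d k - d (S k)))).
  fold (A j) (A n).
  assert (HA : forall k, A (S k) = A k + bpmf n p (S k) * d (S k)) by reflexivity.
  assert (HW : forall k, W (S k) = W k + bcdf n p k * (1 - bcdf n p k) * Rabs (d k - d (S k)))
    by reflexivity.
  assert (HA0 : A O = bcdf n p 0 * d O) by (unfold A; rewrite bcdf_0; simpl; ring).
  pose proof (bcdf_bounds n j p Hp Hj) as Fj.
  (* [L j] is the sum of F(k) (d(k) - d(k+1)) over k < j, and [U j] is minus the sum of (1 - F(k))
     (d(k) - d(k+1)) over j <= k < n. *)
  set (L := fun k => A k - bcdf n p k * d k).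
  set (U := fun k => A n - A k - (1 - bcdf n p k) * d k).
  assert (HL : forall k, (k <= j)%nat -> (1 - bcdf n p j) * Rabs (L k) <= W k).
  { induction k as [|k IH]; intros Hk.
    - unfold L; rewrite HA0, Rminus_eq_0, Rabs_R0; unfold W; simpl; lra.
    - specialize (IH ltac:(lia)).
      replace (L (S k)) with (L k + bcdf n p k * (d k - d (S k)))
        by (unfold L; rewrite HA, bcdf_S; ring).
      pose proof (bcdf_bounds n k p Hp ltac:(lia)) as Fk.
      pose proof (bcdf_mono n k j p Hp ltac:(lia)) as Fkj.
      rewrite HW; eapply Rle_trans.
      + apply Rmult_le_compat_l; [lra | apply Rabs_triang].
      + rewrite Rabs_mult, (Rabs_pos_eq (bcdf n p k)) by lra.
        assert (0 <= bcdf n p k * Rabs (d k - d (S k)))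
          by (apply Rmult_le_pos; [lra | apply Rabs_pos]).
        nra. }
  assert (HU : forall k, (j <= k)%nat -> (k <= n)%nat -> bcdf n p j * Rabs (U j - U k) <= W k - W j).
  { intros k Hk; induction Hk as [|k Hk IH]; intros Hkn.
    - rewrite !Rminus_eq_0, Rabs_R0; lra.
    - specialize (IH ltac:(lia)).
      replace (U j - U (S k)) with ((U j - U k) - (1 - bcdf n p k) * (d k - d (S k)))
        by (unfold U; rewrite HA, bcdf_S; ring).
      pose proof (bcdf_bounds n k p Hp ltac:(lia)) as Fk.
      pose proof (bcdf_mono n j k p Hp ltac:(lia)) as Fkj.
      rewrite HW; unfold Rminus at 1; eapply Rle_trans.
      + apply Rmult_le_compat_l; [lra | apply Rabs_triang].
      + rewrite Rabs_Ropp, Rabs_mult, (Rabs_pos_eq (1 - bcdf n p k)) by lra.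
        assert (0 <= (1 - bcdf n p k) * Rabs (d k - d (S k)))
          by (apply Rmult_le_pos; [lra | apply Rabs_pos]).
        nra. }
  specialize (HL j ltac:(lia)); specialize (HU n Hj ltac:(lia)).
  replace (U n) with 0 in HU by (unfold U; rewrite bcdf_top; ring); rewrite Rminus_0_r in HU.
  replace (A j - bcdf n p j * A n) with ((1 - bcdf n p j) * L j + - (bcdf n p j * U j))
    by (unfold L, U; ring).
  eapply Rle_trans; [apply Rabs_triang|].
  rewrite Rabs_Ropp, !Rabs_mult, (Rabs_pos_eq (1 - bcdf n p j)), (Rabs_pos_eq (bcdf n p j)) by lra.
  lra.
Qed.

(** * The expansion of the distribution function *)

Lemma bcdf_edgeworth : exists C, 0 <= C /\
  forall (n j : nat) (p s : R), 0 < p < 1 -> 4 <= s -> s ^ 2 = INR n * p * (1 - p) ->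
    (j <= n)%nat ->
    Rabs (bcdf n p j - edgeworth p (/ s) ((INR j - INR n * p + / 2) * / s)) <= C * (/ s) ^ 5.
Proof.
  destruct stein_edgeworth_bound as [Cs [HCs Hstein]], edgeworth_tails as [Ct [HCt Htail]].
  (* 3840 = 320 * 12 combines [bcdf_var_le_flow] with [cauchy_sum_bound]; 2 [Ct] pays for the two
     ends of the lattice. *)
  exists (3840 * Cs + 2 * Ct); split; [lra|]; intros n j p s Hp Hs HV Hj.
  set (h := / s).
  assert (Hh : 0 < h <= 1).
  { unfold h; split; [apply Rinv_0_lt_compat; lra|].
    rewrite <- Rinv_1; apply Rinv_le_contravar; lra. }
  assert (Hsh : s * h = 1) by (apply Rinv_r; lra).
  set (a := (- INR n * p + / 2) * h).
  set (Y := fun k => a + INR k * h).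
  replace ((INR j - INR n * p + / 2) * h) with (Y j) by (unfold Y, a; ring).
  set (G := edgeworth p h).
  (* The increments of G relative to the binomial mass, so that the sums of b d telescope. *)
  set (d := fun k => (G (Y k) - G (Y k - h)) / bpmf n p k).
  assert (Hbd : forall m, psum (fun k => bpmf n p k * d k) (S m) = G (Y m) - G (a - h)).
  { intros m.
    transitivity (psum (fun k => G (a - h + INR (S k) * h) - G (a - h + INR k * h)) (S m)).
    - apply psum_ext; intros k _; unfold d.
      replace (a - h + INR (S k) * h) with (Y k) by (unfold Y; rewrite S_INR; ring).
      replace (a - h + INR k * h) with (Y k - h) by (unfold Y; ring).
      field; apply Rgt_not_eq, bpmf_pos, Hp.
    - rewrite (psum_telescope (fun k => G (a - h + INR k * h))).
      replace (a - h + INR (S m) * h) with (Y m) by (unfold Y; rewrite S_INR; ring).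
      simpl INR; do 2 f_equal; ring. }
  (* Multiplied by s^2, the two factors in [stein] become (n - k) p and (k + 1) (1 - p). *)
  assert (Hflow : forall k, (k < n)%nat -> flow n p k * (d k - d (S k)) = s ^ 2 * stein G p h (Y k)).
  { intros k Hk.
    assert (H1 : flow n p k * d k = (INR n - INR k) * p * (G (Y k) - G (Y k - h)))
      by (unfold flow, d; field; apply Rgt_not_eq, bpmf_pos, Hp).
    assert (H2 : flow n p k * d (S k) = (INR k + 1) * (1 - p) * (G (Y k + h) - G (Y k))).
    { rewrite flow_balance by exact Hk; unfold d.
      replace (Y (S k)) with (Y k + h) by (unfold Y; rewrite S_INR; ring).
      replace (Y k + h - h) with (Y k) by ring.
      field; apply Rgt_not_eq, bpmf_pos, Hp. }
    assert (HY : Y k * h * s ^ 2 = INR k - INR n * p + / 2).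
    { unfold Y, a.
      transitivity ((INR k - INR n * p + / 2) * (s * h) * (s * h)); [ring | rewrite Hsh; ring]. }
    assert (Hh2 : s ^ 2 * h ^ 2 = 1)
      by (replace (s ^ 2 * h ^ 2) with ((s * h) * (s * h)) by ring; rewrite Hsh; ring).
    rewrite Rmult_minus_distr_l, H1, H2; unfold stein.
    replace ((INR n - INR k) * p) with (s ^ 2 - p * (Y k * h * s ^ 2) + p * (s ^ 2 * h ^ 2) / 2)
      by (rewrite HY, Hh2, HV; field).
    replace ((INR k + 1) * (1 - p))
      with (s ^ 2 + (1 - p) * (Y k * h * s ^ 2) + (1 - p) * (s ^ 2 * h ^ 2) / 2)
      by (rewrite HY, Hh2, HV; field).
    field. }
  assert (Hsum : psum (fun k => bcdf n p k * (1 - bcdf n p k) * Rabs (d k - d (S k))) n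
                 <= 3840 * Cs * h ^ 5).
  { apply Rle_trans with
      (* The void summand 0 * 0 gives the sum the shape of [psum_lin]. *)
      (psum (fun k => 320 * Cs * h ^ 5 * (h / (1 + (a + INR k * h) ^ 2)) + 0 * 0) n).
    - apply psum_le; intros k Hk.
      fold (Y k).
      pose proof (bcdf_var_le_flow n k p s Hp Hs HV ltac:(lia)) as Hvar.
      pose proof (Rabs_pos (d k - d (S k))) as Hd.
      assert (Hpos : 0 < flow n p k).
      { rewrite flow_balance by exact Hk; pose proof (pos_INR k).
        apply Rmult_lt_0_compat; [apply Rmult_lt_0_compat; lra | apply bpmf_pos, Hp]. }
      assert (Hst : flow n p k * Rabs (d k - d (S k)) <= s ^ 2 * (Cs * h ^ 7 / (1 + Y k ^ 2))).
      { rewrite <- (Rabs_pos_eq (flow n p k)) by lra.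
        rewrite <- Rabs_mult, Hflow, Rabs_mult, (Rabs_pos_eq (s ^ 2)) by (exact Hk || nra).
        apply Rmult_le_compat_l; [nra | apply Hstein; lra]. }
      apply Rmult_le_reg_l with (s / 320); [lra|].
      apply Rle_trans with (flow n p k * Rabs (d k - d (S k))).
      + rewrite <- Rmult_assoc; apply Rmult_le_compat_r; [exact Hd | lra].
      + eapply Rle_trans; [exact Hst | right].
        unfold h; field; repeat split; nra.
    - rewrite (psum_lin _ _ _ (fun _ => 0)).
      pose proof (cauchy_sum_bound a h n Hh) as Hc.
      assert (0 <= 320 * Cs * h ^ 5) by (repeat apply Rmult_le_pos; try lra; apply pow_le; lra).
      nra. }
  pose proof (abel_cdf_bound n j p d Hp Hj) as Habel.
  rewrite !Hbd in Habel.
  (* The lattice ends are a - h = - (np + 1/2) h and Y(n) = (n (1 - p) + 1/2) h; both exceed s in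
     absolute value, as np and n (1 - p) are at least s^2. *)
  assert (Hsn : s <= (INR n * p + / 2) * h /\ s <= (INR n * (1 - p) + / 2) * h).
  { pose proof (pos_INR n).
    split; apply Rmult_le_reg_l with s; try lra; rewrite (Rmult_comm _ h), <- Rmult_assoc, Hsh; nra. }
  assert (Hsi : s = / h) by (unfold h; rewrite Rinv_inv; reflexivity).
  destruct Hsn as [Hlo Hhi]; rewrite Hsi in Hlo, Hhi.
  destruct (Htail p h _ ltac:(lra) Hh Hlo) as [_ Tlo].
  destruct (Htail p h _ ltac:(lra) Hh Hhi) as [Thi _].
  replace (- ((INR n * p + / 2) * h)) with (a - h) in Tlo by (unfold a; field).
  replace ((INR n * (1 - p) + / 2) * h) with (Y n) in Thi by (unfold Y, a; field).
  fold G in Tlo, Thi.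
  pose proof (bcdf_bounds n j p Hp Hj) as HF.
  assert (H5 : 0 <= Ct * h ^ 5) by (apply Rmult_le_pos; [lra | apply pow_le; lra]).
  apply Rabs_le_between in Habel, Tlo, Thi; apply Rabs_le_between.
  rewrite Rmult_plus_distr_r.
  set (X := G (Y j) - G (a - h) - bcdf n p j * (G (Y n) - G (a - h))) in *.
  replace (bcdf n p j - G (Y j))
    with (- X - (1 - bcdf n p j) * G (a - h) + bcdf n p j * (1 - G (Y n))) by (unfold X; ring).
  nra.
Qed.

(** The midpoint between c and a finite limit inferior leaves a gap on both sides; c + 1 serves for
    an infinite one. *)
Lemma LimInf_seq_gt (u : nat -> R) (c : R) : Rbar_lt c (LimInf_seq u) ->
  exists a, c < a /\ exists N, forall n, (N <= n)%nat -> a < u n.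
Proof.
  unfold LimInf_seq; destruct (ex_LimInf_seq u) as [l Hl]; simpl.
  destruct l as [l| |]; simpl; intros Hc; [| |contradiction].
  - assert (He : 0 < (l - c) / 2) by lra.
    destruct (Hl (mkposreal _ He)) as [_ [N HN]]; simpl in HN.
    exists ((l + c) / 2); split; [lra|]; exists N; intros n Hn; specialize (HN n Hn); lra.
  - destruct (Hl (c + 1)) as [N HN]; exists (c + 1); split; [lra | exists N; exact HN].
Qed.

Lemma LimSup_seq_lt (u : nat -> R) (c : R) : Rbar_lt (LimSup_seq u) c ->
  exists a, a < c /\ exists N, forall n, (N <= n)%nat -> u n < a.
Proof.
  unfold LimSup_seq; destruct (ex_LimSup_seq u) as [l Hl]; simpl.
  destruct l as [l| |]; simpl; intros Hc; [|contradiction|].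
  - assert (He : 0 < (c - l) / 2) by lra.
    destruct (Hl (mkposreal _ He)) as [_ [N HN]]; simpl in HN.
    exists ((l + c) / 2); split; [lra|]; exists N; intros n Hn; specialize (HN n Hn); lra.
  - destruct (Hl (c - 1)) as [N HN]; exists (c - 1); split; [lra | exists N; exact HN].
Qed.

Theorem theorem3p1 (p : nat -> R) (j : nat -> nat) :
  Rbar_lt (Finite 0) (LimInf_seq p) ->
  Rbar_lt (LimSup_seq p) (Finite 1) ->
  (forall n, (j n <= n)%nat) ->
  exists C : R, exists N : nat, forall n : nat, (N <= n)%nat ->
    let pn := p n in
    let qn := 1 - p n in
    let V := INR n * pn * qn in
    let y := (INR (j n) - INR n * pn + / 2) / sqrt V in
    Rabs (binom_cdf n (j n) pn
          - (Phi y
             + exp (- / 2 * y ^ 2) / sqrt (2 * PI) *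
               (P1 pn qn y / sqrt V + P2 pn qn y / V
                + P3 pn qn y / (V * sqrt V) + P4 pn qn y / V ^ 2)))
      <= C / (INR n ^ 2 * sqrt (INR n)).
Proof.
  intros Hinf Hsup Hj.
  destruct (LimInf_seq_gt p 0 Hinf) as [a [Ha [N1 HN1]]].
  destruct (LimSup_seq_lt p 1 Hsup) as [b [Hb [N2 HN2]]].
  destruct bcdf_edgeworth as [C [HC Hmain]].
  (* A common lower bound for p and q far out in the sequence, whence V >= n c^2. *)
  set (c := Rmin a (1 - b)).
  assert (Hc : 0 < c) by (apply Rmin_glb_lt; lra).
  (* From n > 16/c^2 follows V >= 16, hence s >= 4 as [bcdf_edgeworth] demands. *)
  destruct (nfloor_ex (16 / c ^ 2)) as [N3 [_ HN3]].
  { left; apply Rdiv_lt_0_compat; [lra | apply pow_lt, Hc]. }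
  (* Since s >= c sqrt n, the error C / s^5 is at most (C / c^5) n^(-5/2). *)
  exists (C / c ^ 5), (N1 + N2 + S N3)%nat; intros n Hn pn qn V y.
  assert (Hpn : c <= pn).
  { apply Rle_trans with a; [apply Rmin_l | left; apply HN1; lia]. }
  assert (Hqn : c <= qn).
  { apply Rle_trans with (1 - b); [apply Rmin_r | unfold qn; specialize (HN2 n ltac:(lia)); lra]. }
  assert (Hp : 0 < pn < 1) by (unfold qn in Hqn; fold pn in Hqn; lra).
  assert (HnN : 16 / c ^ 2 < INR n).
  { eapply Rlt_le_trans; [exact HN3|]; rewrite <- S_INR; apply le_INR; lia. }
  assert (Hc2 : c ^ 2 > 0) by (apply pow_lt, Hc).
  assert (Hn16 : 16 <= INR n * c ^ 2) by (left; apply (proj1 (Rlt_div_l _ _ _ Hc2)), HnN).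
  assert (Hn0 : 0 < INR n) by nra.
  assert (HVn : INR n * c ^ 2 <= V).
  { unfold V; rewrite Rmult_assoc; apply Rmult_le_compat_l; [lra | nra]. }
  set (s := sqrt V) in *.
  assert (HsV : s * s = V) by (apply sqrt_sqrt; lra).
  assert (Hscn : c * sqrt (INR n) <= s).
  { replace (c * sqrt (INR n)) with (sqrt (INR n * c ^ 2)); [apply sqrt_le_1_alt, HVn|].
    rewrite sqrt_mult_alt, sqrt_pow2 by lra; ring. }
  assert (Hs : 4 <= s).
  { unfold s; replace 4 with (sqrt (4 * 4)) by (apply sqrt_square; lra).
    apply sqrt_le_1_alt; lra. }
  specialize (Hmain n (j n) pn s Hp Hs ltac:(rewrite <- Rsqr_pow2; exact HsV) (Hj n)).
  assert (Hcdf : binom_cdf n (j n) pn = bcdf n pn (j n)) by apply sum_f_R0_psum.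
  rewrite Hcdf, Phi_eq.
  match goal with |- Rabs (_ - ?e) <= _ =>
    replace e with (edgeworth pn (/ s) ((INR (j n) - INR n * pn + / 2) * / s)) end.
  - eapply Rle_trans; [exact Hmain|].
    unfold Rdiv; rewrite Rmult_assoc; apply Rmult_le_compat_l; [exact HC|].
    rewrite <- Rinv_mult, pow_inv.
    pose proof (sqrt_lt_R0 _ Hn0) as Hsn.
    apply Rinv_le_contravar.
    + repeat apply Rmult_lt_0_compat; try lra; apply pow_lt; lra.
    + replace (c ^ 5 * (INR n ^ 2 * sqrt (INR n))) with ((c * sqrt (INR n)) ^ 5).
      * apply pow_incr; nra.
      * rewrite <- (sqrt_sqrt (INR n)) at 2 by lra; ring.
  - change ((INR (j n) - INR n * pn + / 2) * / s) with y.
    unfold edgeworth, std_normal_density; change (1 - pn) with qn.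
    replace (- / 2 * y ^ 2) with (- y ^ 2 / 2) by field.
    rewrite <- HsV; field; repeat split; try lra.
    apply Rgt_not_eq, sqrt_2PI_pos.
Qed.
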